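(* Let $m\ge1$. For any $n\in\mathbb N$ (i.e. $n\ge 1$) there are short exact sequences $$0\to\mathcal T_{2n}\to\mathcal T^\infty_{2n}\to\mathbb Z_2\otimes\mathsf L'_{n+1}\to0,$$ $$0\to\mathbb Z_2\otimes\mathsf L'_{n+1}\to\widetilde{\mathcal T}_{2n-1}\to\mathcal T^\infty_{2n-1}\to0,$$ where $\mathcal T_{2n}\to\mathcal T^\infty_{2n}$ is the canonical map sending an unrooted tree to itself and $\widetilde{\mathcal T}_{2n-1}\to\mathcal T^\infty_{2n-1}$ is the canonical quotient map.
   Context: Fix $m\ge1$. $\mathsf L'_n$ is the degree $n$ part of the free quasi-Lie algebra over $\mathbb Z$ on generators $X_1,\dots,X_m$: it is defined like the free Lie algebra except that the relation $[X,X]=0$ is replaced by the weaker relation $[X,Y]=-[Y,X]$ (the Jacobi identity is kept). Trees are finite unitrivalent trees with a cyclic ordering of the edges at each trivalent vertex; the order is the number of trivalent vertices. Univalent vertices are labeled by $\{1,\dots,m\}$, except that a rooted tree has one distinguished unlabeled univalent vertex (the root). A label $i$ also denotes the order $0$ rooted tree with label $i$. For rooted trees $I,J$, the rooted product $(I,J)$ is obtained by identifying the two roots to a vertex and adjoining a rooted edge there (cyclic order given by the ordering of $I,J$); $\langle I,J\rangle$ is the unrooted tree obtained by gluing the two root edges into a single edge. $-J$ denotes $J$ with one cyclic ordering reversed. AS relation: reversing one cyclic ordering changes the sign. IHX relation: $I-H+X=0$ for three trees which agree except that a rooted subtree $(A,(B,C))$ of $I$ is replaced by $((A,B),C)$ in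 $H$ and by $((A,C),B)$ in $X$. - $\mathcal T_n$: abelian group generated by order $n$ unrooted trees modulo AS and IHX. - $\widetilde{\mathcal T}_{2n-1}$: quotient of $\mathcal T_{2n-1}$ by the image of $\Delta:\mathbb Z_2\otimes\mathcal T_{n-1}\to\mathcal T_{2n-1}$, $\Delta(t)=\sum_v\langle i(v),(T_v(t),T_v(t))\rangle$, summing over univalent vertices $v$ of $t$, where $i(v)$ is the label of $v$ and $T_v(t)$ is the rooted tree obtained by replacing $v$ by a root. - $\mathcal T^\infty_{2n-1}$: quotient of $\widetilde{\mathcal T}_{2n-1}$ by $\langle(i,J),J\rangle=0$ for all labels $i$ and order $n-1$ rooted trees $J$. - $\mathcal T^\infty_{2n}$: generated by $\mathcal T_{2n}$ and symbols $J^\infty$ for order $n$ rooted trees $J$, with the additional relations $J^\infty=(-J)^\infty$, $2J^\infty=\langle J,J\rangle$, and $I^\infty=H^\infty+X^\infty-\langle H,X\rangle$ whenever $I,H,X$ are rooted trees as in an IHX relation $I=H-X$. *)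

(* Defs.v *)
From HB Require Import structures.
From mathcomp Require Import all_boot all_fingroup ssralg ssrnum ssrint zmodp.
From mathcomp Require Import generic_quotient ring_quotient.
From mathcomp Require Import boolp.
From mathcomp Require Import freeg.

Set Implicit Arguments.
Unset Strict Implicit.
Unset Printing Implicit Defensive.

Import GRing.Theory.
Local Open Scope ring_scope.
Local Open Scope quotient_scope.

Section SpanAndQuotient.
Variables (V : zmodType) (S : V -> Prop).

Inductive spanned : V -> Prop :=
| spanned_gen x : S x -> spanned x
| spanned0 : spanned 0
| spannedB x y : spanned x -> spanned y -> spanned (x - y).

Definition zspan : {pred V} := [pred x | `[< spanned x >]].

Lemma zspan_zmod_closed : zmod_closed zspan.
Proof.
split=> [|x y]; first by apply/asboolP; exact: spanned0.
by move=> /asboolP hx /asboolP hy; apply/asboolP; exact: spannedB.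
Qed.

HB.instance Definition _ := GRing.isZmodClosed.Build V zspan zspan_zmod_closed.

(* V modulo the relations r = 0 for r in S. *)
Definition zquot : zmodType := Quotient.quot zspan.

Definition zpi (x : V) : zquot := \pi x.

Lemma zpi_is_zmod_morphism : zmod_morphism zpi.
Proof. exact: pi_is_zmod_morphism. Qed.

HB.instance Definition _ :=
  GRing.isZmodMorphism.Build V zquot zpi zpi_is_zmod_morphism.

Definition zsub_type := {x : V | x \in zspan}.
HB.instance Definition _ := SubChoice.on zsub_type.
HB.instance Definition _ := [SubChoice_isSubZmodule of zsub_type by <:].
Definition zsub : zmodType := zsub_type.

End SpanAndQuotient.

Section Tensor.
Variables A B : zmodType.

Inductive tensor_rel : {freeg (A * B)%type} -> Prop :=
| tensorDl a a' b :
    tensor_rel (<< (a + a', b) >> - << (a, b) >> - << (a', b) >>)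
| tensorDr a b b' :
    tensor_rel (<< (a, b + b') >> - << (a, b) >> - << (a, b') >>).

Definition tensor : zmodType := zquot tensor_rel.

End Tensor.

Definition short_exact (A B C : zmodType)
    (f : {additive A -> B}) (g : {additive B -> C}) : Prop :=
  [/\ injective f,
      forall y, g y = 0 <-> exists x, f x = y
    & forall z, exists y, g y = z].

(* An isomorphism class of rooted trees with a cyclic ordering at each
   trivalent vertex is a planar binary tree: at each trivalent vertex the edge
   towards the root comes first and is followed by the two children in order.
   So [Node I J] is the rooted product (I, J). *)
Inductive rtree (m : nat) : Type :=
| Leaf of 'I_m
| Node of rtree m & rtree m.

Section RootedTreeChoice.
Variable m : nat.

Fixpoint rtree_encode (J : rtree m) : GenTree.tree 'I_m :=
  match J with
  | Leaf i => GenTree.Leaf i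
  | Node A B => GenTree.Node 0 [:: rtree_encode A; rtree_encode B]
  end.

Fixpoint rtree_decode (u : GenTree.tree 'I_m) : option (rtree m) :=
  match u with
  | GenTree.Leaf i => Some (Leaf i)
  | GenTree.Node _ [:: a; b] =>
      match rtree_decode a, rtree_decode b with
      | Some A, Some B => Some (Node A B)
      | _, _ => None
      end
  | _ => None
  end.

Lemma rtree_encodeK : pcancel rtree_encode rtree_decode.
Proof. by elim=> [i|A hA B hB] //=; rewrite hA hB. Qed.

HB.instance Definition _ := Countable.copy (rtree m) (pcan_type rtree_encodeK).

End RootedTreeChoice.

Fixpoint rorder m (J : rtree m) : nat :=
  match J with Leaf _ => 0%N | Node A B => (rorder A + rorder B).+1 end.

Definition rtree_of (m n : nat) := {J : rtree m | rorder J == n}.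
HB.instance Definition _ m n := SubChoice.on (rtree_of m n).

(* [rneg J J'] : J' is J with the cyclic ordering at one trivalent vertex
   reversed. *)
Inductive rneg m : rtree m -> rtree m -> Prop :=
| rneg_here A B : rneg (Node A B) (Node B A)
| rneg_left A A' B : rneg A A' -> rneg (Node A B) (Node A' B)
| rneg_right A B B' : rneg B B' -> rneg (Node A B) (Node A B').

(* [rihx I H X] : I, H, X are rooted trees as in an IHX relation I = H - X. *)
Inductive rihx m : rtree m -> rtree m -> rtree m -> Prop :=
| rihx_here A B C :
    rihx (Node A (Node B C)) (Node (Node A B) C) (Node (Node A C) B)
| rihx_left I H X B : rihx I H X -> rihx (Node I B) (Node H B) (Node X B)
| rihx_right A I H X : rihx I H X -> rihx (Node A I) (Node A H) (Node A X).

(* A finite graph with a cyclic ordering of the half-edges at each vertex and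
   without isolated vertices, on the set of half-edges 'I_k: a permutation
   exchanging the two halves of each edge, a permutation sending each half-edge
   to the next one at the same vertex (so the vertices are its orbits), and a
   labeling, which is only used on univalent vertices (the fixed points of the
   second permutation). *)
Definition ribbon (m : nat) :=
  {k : nat & ({perm 'I_k} * {perm 'I_k} * {ffun 'I_k -> 'I_m})%type}.

Section Ribbon.
Variable m : nat.
Implicit Type t : ribbon m.

Definition halfedge t := 'I_(tag t).
HB.instance Definition _ t := Finite.on (halfedge t).

Definition mate t (d : halfedge t) : halfedge t := (tagged t).1.1 d.
Definition turn t : {perm 'I_(tag t)} := (tagged t).1.2.
Definition leaf_label t (d : halfedge t) : 'I_m := (tagged t).2 d.

Definition edges_ok t : bool :=
  [forall d : halfedge t, (mate d != d) && (mate (mate d) == d)].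

Definition unitrivalent t : bool :=
  [forall A in porbits (turn t), (#|A| == 1)%N || (#|A| == 3)%N].

Definition ribbon_connected t : bool :=
  [forall d : halfedge t, forall d' : halfedge t,
     connect (fun x y : halfedge t => (y == mate x) || (y == turn t x)) d d'].

(* A step of a walk without backtracking: from the half-edge d, traverse its
   edge and leave the vertex at the other end through another half-edge. *)
Definition walk_step t : rel (halfedge t) :=
  fun d d' => (d' \in porbit (turn t) (mate d)) && (d' != mate d).

(* There is no closed walk without backtracking. *)
Definition acyclic t : bool :=
  [forall d : halfedge t, forall d' : halfedge t,
     walk_step d d' ==> ~~ connect (@walk_step t) d' d].

Definition is_tree t : bool :=
  [&& (0 < tag t)%N, edges_ok t, unitrivalent t, ribbon_connected t & acyclic t].

Definition torder t : nat := #|[set A in porbits (turn t) | #|A| == 3%N]|.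

Definition univalent t (d : halfedge t) : bool := turn t d == d.

(* [subtree d J] : cutting the edge of d, the part containing the vertex of d,
   rooted at the cut, is the rooted tree J. *)
Inductive subtree t : halfedge t -> rtree m -> Prop :=
| subtree_leaf d : univalent d -> subtree d (Leaf (leaf_label d))
| subtree_node d A B : ~~ univalent d ->
    subtree (mate (turn t d)) A -> subtree (mate (turn t (turn t d))) B ->
    subtree d (Node A B).

(* [glued t I J] : t is the unrooted tree <I, J>. *)
Definition glued t (I J : rtree m) : Prop :=
  exists2 d : halfedge t, subtree d I & subtree (mate d) J.

(* t' is isomorphic to t with the cyclic orderings reversed at the vertices
   whose half-edges make up S. *)
Definition iso_reversing t t' (S : {set halfedge t}) : Prop :=
  exists f : halfedge t -> halfedge t',
    [/\ bijective f,
        forall d, f (mate d) = mate (f d),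
        forall d, univalent d -> leaf_label (f d) = leaf_label d
      & forall d, f (turn t d) =
          if d \in S then (turn t')^-1%g (f d) else turn t' (f d)].

Definition tree_iso t t' : Prop := iso_reversing t' (set0 : {set halfedge t}).

Definition one_reversed t t' : Prop :=
  exists2 d : halfedge t, ~~ univalent d & iso_reversing t' (porbit (turn t) d).

End Ribbon.

Definition utree (m n : nat) :=
  {t : ribbon m | is_tree t && (torder t == n)}.
HB.instance Definition _ m n := SubChoice.on (utree m n).

Inductive T_rel m n : {freeg (utree m n)} -> Prop :=
| T_iso (t t' : utree m n) :
    tree_iso (val t) (val t') -> T_rel (<< t >> - << t' >>)
| T_AS (t t' : utree m n) :
    one_reversed (val t) (val t') -> T_rel (<< t >> + << t' >>)
| T_IHX (I H X : utree m n) A B C D :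
    glued (val I) (Node A (Node B C)) D ->
    glued (val H) (Node (Node A B) C) D ->
    glued (val X) (Node (Node A C) B) D ->
    T_rel (<< I >> - << H >> + << X >>).

Definition T (m n : nat) : zmodType := zquot (@T_rel m n).

Definition Tcl m n (t : utree m n) : T m n := zpi (@T_rel m n) << t >>.

(* The values Delta(1 (x) t), which generate the image of Delta.  The rooted
   tree T_v(t) is the part of t across the edge of the univalent vertex v. *)
Inductive Delta_value m n : T m (2 * n).-1 -> Prop :=
| Delta_sum (t : utree m n.-1) (w : halfedge (val t) -> utree m (2 * n).-1) :
    (forall v, univalent v ->
       exists2 Tv, subtree (mate v) Tv
                 & glued (val (w v)) (Leaf (leaf_label v)) (Node Tv Tv)) ->
    Delta_value (\sum_(v | univalent v) Tcl (w v)).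

Definition Ttilde (m n : nat) : zmodType := zquot (@Delta_value m n).

(* The group T^oo_(2n-1), for n > 0. *)
Inductive Tinf_odd_rel m n : Ttilde m n -> Prop :=
| boundary_twist (i : 'I_m) (J : rtree_of m n.-1) (t : utree m (2 * n).-1) :
    glued (val t) (Node (Leaf i) (val J)) (val J) ->
    Tinf_odd_rel (zpi (@Delta_value m n) (Tcl t)).

Definition Tinf_odd (m n : nat) : zmodType := zquot (@Tinf_odd_rel m n).

Definition Ttilde_to_Tinf m n : {additive Ttilde m n -> Tinf_odd m n} :=
  zpi (@Tinf_odd_rel m n).

(* The group T^oo_(2n); the symbol J^oo is << J >> in the second factor. *)
Inductive Tinf_even_rel m n :
    (T m (2 * n) * {freeg (rtree_of m n)})%type -> Prop :=
| inf_neg (J J' : rtree_of m n) :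
    rneg (val J) (val J') -> Tinf_even_rel (0, << J >> - << J' >>)
| inf_double (J : rtree_of m n) (t : utree m (2 * n)) :
    glued (val t) (val J) (val J) -> Tinf_even_rel (- Tcl t, << J >> *+ 2)
| inf_IHX (I H X : rtree_of m n) (t : utree m (2 * n)) :
    rihx (val I) (val H) (val X) -> glued (val t) (val H) (val X) ->
    Tinf_even_rel (Tcl t, << I >> - << H >> - << X >>).

Definition Tinf_even (m n : nat) : zmodType := zquot (@Tinf_even_rel m n).

Definition T_to_Tinf_fun m n (x : T m (2 * n)) : Tinf_even m n :=
  zpi (@Tinf_even_rel m n) (x, 0).

Lemma T_to_Tinf_is_zmod_morphism m n : zmod_morphism (@T_to_Tinf_fun m n).
Proof.
by move=> x y; rewrite /T_to_Tinf_fun -raddfB; congr zpi; congr pair; rewrite subr0.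
Qed.

HB.instance Definition _ m n :=
  GRing.isZmodMorphism.Build _ _ (@T_to_Tinf_fun m n)
    (@T_to_Tinf_is_zmod_morphism m n).

Definition T_to_Tinf m n : {additive T m (2 * n) -> Tinf_even m n} :=
  @T_to_Tinf_fun m n.

Section QuasiLie.
Variable m : nat.

(* The free nonassociative algebra over Z on m generators: its monomials are
   the rooted trees. *)
Definition bracket (x y : {freeg (rtree m)}) : {freeg (rtree m)} :=
  fglift (fun A => fglift (fun B => << Node A B >> : {freeg (rtree m)}) y) x.

(* Additive generators of the two-sided ideal of relations. *)
Inductive quasi_lie_rel : {freeg (rtree m)} -> Prop :=
| ql_antisym x y : quasi_lie_rel (bracket x y + bracket y x)
| ql_jacobi x y z :
    quasi_lie_rel (bracket x (bracket y z) + bracket y (bracket z x)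
                   + bracket z (bracket x y))
| ql_idealr x r : quasi_lie_rel r -> quasi_lie_rel (bracket x r)
| ql_ideall x r : quasi_lie_rel r -> quasi_lie_rel (bracket r x).

Definition quasi_lie : zmodType := zquot quasi_lie_rel.

(* The degree of a monomial is its number of leaves. *)
Fixpoint rdegree (J : rtree m) : nat :=
  match J with Leaf _ => 1%N | Node A B => (rdegree A + rdegree B)%N end.

Inductive quasi_lie_monomial (n : nat) : quasi_lie -> Prop :=
| QLMonomial J :
    rdegree J = n -> quasi_lie_monomial n (zpi quasi_lie_rel << J >>).

(* The degree n part, spanned by the monomials of degree n. *)
Definition Lprime (n : nat) : zmodType := zsub (quasi_lie_monomial n).

End QuasiLie.

(* Main.v *)
Require Import Defs.
From HB Require Import structures.
From mathcomp Require Import all_boot all_order all_fingroup ssralg ssrnum ssrint zmodp.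
From mathcomp Require Import generic_quotient ring_quotient.
From mathcomp Require Import boolp.
From mathcomp Require Import freeg.
From mathcomp Require Import zify.

(** Both sequences compare trees with the free quasi-Lie algebra [L'], whose
    degree [n + 1] part is presented by the rooted trees of order [n] with the
    antisymmetry and Jacobi relations.

    A tree is a graph here, but it is determined by the two rooted trees [I], [J]
    found at the ends of any of its edges ([glued_iso]), and the cut may be moved
    to any other edge ([glued_move]).  So [T] is generated by symbols [<I, J>],
    with a universal property that mentions rooted trees only ([Tlift]), and
    gluing is a symmetric bilinear form on [L'] ([form]).

    First sequence.  The symbols [J^oo] form a quadratic refinement of this form,
    universal with [2 J^oo = <J, J>].  Any symmetric bilinear [f] on an abelian
    group [A] with values in [M] gives a group [M x A] with the law
    [(a, x) + (b, y) = (a + b - f x y, x + y)], in which [(0, x)] is a quadratic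
    refinement of [f], and [2 (0, x) - (f x x, 0) = (- 2 f x x, 2 x)] is additive
    in [x].  All the relations of the twisted group are of this form.  One of them
    is central only if [2 x = 0], and then [2 f x x = f (2 x) x = 0].  Hence trees
    inject ([T_to_Tinf_inj]); modulo trees, [J^oo] is a free symbol for the class
    of [J] modulo 2 ([Tinf_to_tensor_ker]).

    Second sequence.  Write [V] for the free abelian group on the labels.  The map
    [i (x) J |-> <i, (J, J)>] is additive, because squares are additive in a
    quasi-Lie algebra, and 2-torsion.  Sending a tree to the sum of [i(v) (x) T_v]
    over its leaves presents [L'_(n+1)] as the cokernel of a map from
    [T_(n-1)] to [V (x) L'_n], where [i (x) J] goes to [[i, J]]: one recovers the
    inverse by summing over the leaves of [A] in the tree [(A, B)] ([lsum_root],
    [brackets_eta]).  As [Delta] is the composition of these two maps, the map from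
    [V (x) L'_n] descends to one from [Z/2 (x) L'_(n+1)] to [Ttilde], whose image is
    the group of boundary twists ([exists_boundary], [boundary_ker]).

    It is injective because if a sum of classes [<i, (J_i, J_i)>] vanishes then so
    does the sum of the [[i, J_i]] modulo 2 ([twists_eq0]).  Indeed the sum over
    the leaves of [<i, (J, J)>] is [i (x) [J, J]], so each [[J_i, J_i]] vanishes
    in [L'].  The square [[J, J]] determines the coefficients of [J] modulo 2 in the
    free associative algebra ([qdiag_square]): with [T] that algebra over [F2], the
    direct sum of the Lie algebra of [T], of the left module [T], and of its
    symmetric square is a quasi-Lie algebra in which [[J, J]] has the component
    [J . J], where [u . u] occurs as often as [u] in [J].  Finally the free Lie
    algebra over [F2] embeds into [T], which is shown with the basis of Lyndon
    trees ([insensitive_eq0]).  So [J_i] is a sum of doubles and squares [[y, y]],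
    and [[i, J_i]] is even, because [[i, [y, y]] = 0] in a quasi-Lie algebra. *)

Set Implicit Arguments.
Unset Strict Implicit.
Unset Printing Implicit Defensive.

Import GRing.Theory.
Local Open Scope ring_scope.
Local Open Scope quotient_scope.

(** * Linear identities in abelian groups *)

(** Formal integer combinations, to prove by computation of coefficients the
    identities that hold in every abelian group. *)
Inductive zexp : Type :=
| ZVar of nat
| ZZero
| ZAdd of zexp & zexp
| ZOpp of zexp
| ZMuln of zexp & nat.

Fixpoint zeval (V : zmodType) (env : seq V) (e : zexp) : V :=
  match e with
  | ZVar i => env`_i
  | ZZero => 0
  | ZAdd a b => zeval env a + zeval env b
  | ZOpp a => - zeval env a
  | ZMuln a k => zeval env a *+ k
  end.

Fixpoint zcoef (e : zexp) (i : nat) : int :=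
  match e with
  | ZVar j => (i == j)%:Z
  | ZZero => 0
  | ZAdd a b => zcoef a i + zcoef b i
  | ZOpp a => - zcoef a i
  | ZMuln a k => zcoef a i * k%:Z
  end.

Lemma zevalE (V : zmodType) (env : seq V) e :
  zeval env e = \sum_(i < size env) env`_i *~ zcoef e i.
Proof.
elim: e => [j||a IHa b IHb|a IHa|a IHa k] /=.
- have [j_lt|j_ge] := ltnP j (size env); last first.
    rewrite nth_default // big1 // => i _; case: eqP => [ij|//].
    by move: (ltn_ord i); rewrite ij ltnNge j_ge.
  rewrite (bigD1 (Ordinal j_lt)) //= eqxx big1 ?addr0 // => i.
  by rewrite -val_eqE /= => /negPf ->.
- by rewrite big1.
- by rewrite IHa IHb -big_split; apply: eq_bigr => i _; rewrite mulrzDr.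
- by rewrite IHa -sumrN; apply: eq_bigr => i _; rewrite mulrNz.
- by rewrite IHa -sumrMnl; apply: eq_bigr => i _; rewrite mulrzA.
Qed.

Lemma zeval_eq (V : zmodType) (env : seq V) a b :
  all (fun i => zcoef a i == zcoef b i) (iota 0 (size env)) -> zeval env a = zeval env b.
Proof.
move/allP => ab; rewrite !zevalE; apply: eq_bigr => i _.
by rewrite (eqP (ab i _)) // mem_iota add0n /=.
Qed.

Ltac zindex x l :=
  match l with
  | x :: _ => constr:(O)
  | _ :: ?l' => let k := zindex x l' in constr:(S k)
  end.

Ltac zmember x l :=
  match l with
  | x :: _ => constr:(true)
  | _ :: ?l' => zmember x l'
  | _ => constr:(false)
  end.

Ltac zatoms V t l :=
  match t with
  | (?a + ?b)%R => let l' := zatoms V a l in zatoms V b l'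
  | (- ?a)%R => zatoms V a l
  | (?a *+ ?k)%R => zatoms V a l
  | 0%R => l
  | _ => match zmember t l with
         | true => l
         | false => constr:(@cons V t l)
         end
  end.

Ltac zreify t l :=
  match t with
  | (?a + ?b)%R => let ra := zreify a l in let rb := zreify b l in constr:(ZAdd ra rb)
  | (- ?a)%R => let ra := zreify a l in constr:(ZOpp ra)
  | (?a *+ ?k)%R => let ra := zreify a l in constr:(ZMuln ra k)
  | 0%R => constr:(ZZero)
  | _ => let k := zindex t l in constr:(ZVar k)
  end.

Ltac abel :=
  match goal with
  | |- @eq ?V ?a ?b =>
    let l := zatoms V a (@nil V) in let l := zatoms V b l in
    let ra := zreify a l in let rb := zreify b l in
    exact (@zeval_eq _ l ra rb isT)
  end.

Lemma zeval_eq2 (V : zmodType) (env : seq V) a b : (forall x : V, x + x = 0) ->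
  all (fun i => ~~ odd `|zcoef a i - zcoef b i|%N) (iota 0 (size env)) ->
  zeval env a = zeval env b.
Proof.
move=> V2 /allP ab; rewrite !zevalE; apply: eq_bigr => i _.
apply/eqP; rewrite -subr_eq0 -mulrzBr.
have := ab i; rewrite mem_iota add0n /= ltn_ord => /(_ isT).
set k := _ - _ => /even_halfK kE.
have E : env`_i *+ `|k| = 0 by rewrite -kE -mul2n mulrnA mulr2n V2 mul0rn.
by case: k kE E => j _ /=; rewrite ?NegzE ?mulrNz ?oppr_eq0 => /eqP.
Qed.

Lemma bool_addxx (x : bool) : x + x = 0.
Proof. by case: x. Qed.

(** [abel] for booleans, the field with two elements. *)
Ltac abel2 :=
  match goal with
  | |- @eq ?V ?a ?b =>
    let l := zatoms V a (@nil V) in let l := zatoms V b l in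
    let ra := zreify a l in let rb := zreify b l in
    exact (@zeval_eq2 _ l ra rb bool_addxx isT)
  end.

(** * Free abelian groups and quotients *)

Section FreeLift.
Variables (K : choiceType) (G : zmodType) (f : K -> G).

(** An abelian group is a module over the integers only through its alias
    [zmodule G]; hiding it here lets the target be any [zmodType]. *)
Definition flift (D : {freeg K}) : G := fglift (f : K -> zmodule G) D.

Lemma flift_is_zmod_morphism : zmod_morphism flift.
Proof. by move=> x y; have := @lift_is_additive int K (zmodule G) f x y. Qed.

HB.instance Definition _ :=
  GRing.isZmodMorphism.Build {freeg K} G flift flift_is_zmod_morphism.

Lemma fliftU k : flift << k >> = f k.
Proof. by rewrite /flift liftU scale1r. Qed.

End FreeLift.

Lemma freeg_ind (K : choiceType) (P : {freeg K} -> Prop) :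
  P 0 -> (forall x y, P x -> P y -> P (x - y)) -> (forall k, P << k >>) ->
  forall D, P D.
Proof.
move=> P0 PB PU D.
have PN x : P x -> P (- x) by rewrite -sub0r; apply: PB.
have PD x y : P x -> P y -> P (x + y) by rewrite -{2}(opprK y) => ? ?; apply/PB/PN.
rewrite -(freeg_sumE D); apply: big_ind => // k _.
have PMn i x : P x -> P (x *+ i).
  by move=> Px; elim: i => [|i IH]; rewrite ?mulr0n ?mulrS //; apply: PD.
have -> : << (coeff k D) *g k >> = << k >> *~ (coeff k D).
  by rewrite freeg_mulz; congr (Freeg [:: (_, _)]); rewrite intz.
by case: (coeff k D) => i; rewrite ?NegzE ?mulrNz; do ?apply: PN; apply: PMn.
Qed.

Lemma eq_freeg_additive (K : choiceType) (G : zmodType)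
    (f g : {additive {freeg K} -> G}) :
  (forall k, f << k >> = g << k >>) -> f =1 g.
Proof.
move=> fg; apply: freeg_ind => [|x y fx fy|//]; first by rewrite !raddf0.
by rewrite !raddfB fx fy.
Qed.

Section QuotientLift.
Variables (V : zmodType) (S : V -> Prop).

Lemma zpi_eq0 x : (zpi S x = 0) <-> spanned S x.
Proof.
have E : (x \in zspan S) = (zpi S x == 0).
  by rewrite -[x in LHS]subr0 Quotient.idealrBE /zpi; congr (_ == _); exact: raddf0.
by split=> [/eqP|?]; [rewrite -E => /asboolP|apply/eqP; rewrite -E; apply/asboolP].
Qed.

Lemma zpi_rel x : S x -> zpi S x = 0.
Proof. by move=> Sx; apply/zpi_eq0; apply: spanned_gen. Qed.

Lemma zpi_surj q : exists x, zpi S x = q.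
Proof. by exists (repr q); rewrite /zpi reprK. Qed.

Lemma spanned_ker (W : zmodType) (phi : {additive V -> W}) :
  (forall r, S r -> phi r = 0) -> forall x, spanned S x -> phi x = 0.
Proof.
move=> phiS x; elim=> [//||a b _ a0 _ b0]; first by rewrite raddf0.
by rewrite raddfB a0 b0 subr0.
Qed.

Variables (G : zmodType) (phi : {additive V -> G}).
Hypothesis phiS : forall r, S r -> phi r = 0.

Definition zlift of (forall r, S r -> phi r = 0) : zquot S -> G :=
  fun q => phi (repr q).

Lemma zliftE x : zlift phiS (zpi S x) = phi x.
Proof.
apply/eqP; rewrite -subr_eq0 -raddfB; apply/eqP.
apply: (spanned_ker phiS); apply/zpi_eq0; rewrite raddfB /= {1}/zpi reprK.
by rewrite /zpi subrr.
Qed.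

Lemma zlift_is_zmod_morphism : zmod_morphism (zlift phiS).
Proof.
move=> p q; have [[x <-] [y <-]] := (zpi_surj p, zpi_surj q).
by rewrite -raddfB !zliftE raddfB.
Qed.

HB.instance Definition _ :=
  GRing.isZmodMorphism.Build (zquot S) G (zlift phiS) zlift_is_zmod_morphism.

End QuotientLift.

Arguments zlift : simpl never.

(** * The free quasi-Lie algebra by trees *)

Section QuasiLieTheory.
Variable m : nat.
Notation rtree := (rtree m).
Notation L := (quasi_lie m).

Definition tr (J : rtree) : L := zpi (@quasi_lie_rel m) << J >>.

Lemma qlie_ind (P : L -> Prop) :
  P 0 -> (forall x y, P x -> P y -> P (x - y)) -> (forall J, P (tr J)) ->
  forall x, P x.
Proof.
move=> P0 PB PU x; have [y <-] := zpi_surj x.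
move: y; apply: freeg_ind => [|y z Py Pz|J]; first by rewrite raddf0.
  by rewrite raddfB; apply: PB.
exact: PU.
Qed.

Lemma fglift_flift (K J : choiceType) (f : K -> {freeg J}) : fglift f =1 flift f.
Proof.
have E x y : fglift f (x - y) = fglift f x - fglift f y.
  by have := @lift_is_additive int K {freeg J} f x y.
apply: freeg_ind => [|x y IH IH'|k]; last by rewrite liftU scale1r fliftU.
  by rewrite raddf0 -[X in fglift f X](subrr 0) E subrr.
by rewrite raddfB E IH IH'.
Qed.

(** The relations of the quasi-Lie algebra between trees, instead of elements
    of the free nonassociative algebra. *)
Definition lie_compat (G : zmodType) (f : rtree -> G) : Prop :=
  (forall J J', rneg J J' -> f J + f J' = 0) /\
  (forall I H X, rihx I H X -> f I - f H + f X = 0).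

Lemma bracketE (A : rtree) y : bracket << A >> y = flift (fun B => << Node A B >>) y.
Proof. by rewrite /bracket liftU scale1r fglift_flift. Qed.

Lemma bracketUl (A B : rtree) : bracket << A >> << B >> = << Node A B >>.
Proof. by rewrite bracketE fliftU. Qed.

Lemma bracket_flift x (y : {freeg rtree}) :
  bracket x y = flift (fun A => bracket << A >> y) x.
Proof.
rewrite {1}/bracket fglift_flift; congr (flift _ x).
by apply/funext => A; rewrite bracketE fglift_flift.
Qed.

Lemma bracketBr (x y z : {freeg rtree}) :
  bracket x (y - z) = bracket x y - bracket x z.
Proof.
move: x; apply: freeg_ind => [|x x' IH IH'|A].
- by rewrite !bracket_flift !raddf0 addr0.
- by rewrite !(bracket_flift (x - x')) !raddfB /= -!bracket_flift IH IH' !opprD addrACA.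
- by rewrite !bracketE raddfB.
Qed.

Lemma bracketBl (x y z : {freeg rtree}) :
  bracket (x - y) z = bracket x z - bracket y z.
Proof. by rewrite !(bracket_flift _ z) raddfB. Qed.

Definition bracket_l x : {freeg rtree} -> {freeg rtree} := bracket x.
Definition bracket_r y : {freeg rtree} -> {freeg rtree} := (@bracket m)^~ y.

Lemma bracket_l_zmod_morphism x : zmod_morphism (bracket_l x).
Proof. by move=> y z; apply: bracketBr. Qed.
HB.instance Definition _ x := GRing.isZmodMorphism.Build _ _ (bracket_l x)
  (bracket_l_zmod_morphism x).

Lemma bracket_r_zmod_morphism x : zmod_morphism (bracket_r x).
Proof. by move=> y z; apply: bracketBl. Qed.
HB.instance Definition _ x := GRing.isZmodMorphism.Build _ _ (bracket_r x)
  (bracket_r_zmod_morphism x).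

(** The closure of the relations under brackets with [A] is matched by
    replacing [f] with [f \o Node A] or [f \o (Node^~ A)], which satisfy the same
    hypothesis; hence the induction with [f] generalized. *)
Lemma quasi_lie_rel_flift (G : zmodType) (f : rtree -> G) r :
  lie_compat f -> quasi_lie_rel r -> flift f r = 0.
Proof.
move=> fL rel; elim: rel f fL => {r}
  [x y|x y z|x r _ IH|x r _ IH] f [fN fI].
- move: x; apply: freeg_ind => [|x x' IH IH'|A].
  + by rewrite -/(bracket_r y 0) -/(bracket_l y 0) !raddf0 addr0 raddf0.
  + rewrite -/(bracket_r y _) -/(bracket_l y _) !raddfB /=.
    by rewrite -addrACA -opprD raddfB /= IH IH' subr0.
  move: y; apply: freeg_ind => [|y y' IH IH'|B].
  + by rewrite -/(bracket_r <<A>> 0) -/(bracket_l <<A>> 0) !raddf0 addr0 raddf0.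
  + rewrite -/(bracket_r <<A>> _) -/(bracket_l <<A>> _) !raddfB /=.
    by rewrite -addrACA -opprD raddfB /= IH IH' subr0.
  by rewrite !bracketUl raddfD /= !fliftU; apply/fN/rneg_here.
- pose jac (x y z : {freeg rtree}) := flift f (bracket x (bracket y z) + bracket y (bracket z x)
                   + bracket z (bracket x y)).
  rewrite -/(jac x y z).
  have jacB x1 x2 y1 z1 : jac (x1 - x2) y1 z1 = jac x1 y1 z1 - jac x2 y1 z1.
    rewrite /jac -raddfB /=; congr (flift f _); rewrite !(bracketBl, bracketBr) !opprD.
    by rewrite [RHS]addrACA; congr (_ + _); rewrite addrACA.
  have jacC x1 y1 z1 : jac x1 y1 z1 = jac y1 z1 x1.
    by rewrite /jac -addrA addrC.
  have jac0 y1 z1 : jac 0 y1 z1 = 0 by rewrite -[X in jac X](subrr 0) jacB subrr.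
  move: x; apply: freeg_ind => [//|x x' IH IH'|A]; first by rewrite jacB IH IH' subrr.
  rewrite jacC.
  move: y; apply: freeg_ind => [//|x x' IH IH'|B]; first by rewrite jacB IH IH' subrr.
  rewrite jacC.
  move: z; apply: freeg_ind => [//|x x' IH IH'|C]; first by rewrite jacB IH IH' subrr.
  rewrite jacC /jac !bracketUl !raddfD /= !fliftU.
  rewrite -[RHS](fI _ _ _ (rihx_here A B C)) -!addrA; congr (_ + _); rewrite addrC.
  have := fN _ _ (rneg_here C (Node A B)); move/eqP; rewrite addr_eq0 => /eqP ->.
  congr (_ + _).
  have /eqP := fN _ _ (rneg_right B (rneg_here C A)); rewrite addr_eq0 => /eqP ->.
  have /eqP := fN _ _ (rneg_here B (Node A C)); rewrite addr_eq0 => /eqP ->.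
  by rewrite opprK.
- rewrite bracket_flift; move: x; apply: freeg_ind => [|y y' Hy Hy'|A].
  + by rewrite !raddf0.
  + by rewrite !raddfB /= Hy Hy' subr0.
  rewrite fliftU bracketE.
  rewrite -/((flift f \o flift (fun B => <<Node A B>>)) r).
  rewrite (@eq_freeg_additive _ _ (flift f \o flift (fun B => <<Node A B>>)) (flift (fun B => f (Node A B)))); last first.
    by move=> k /=; rewrite !fliftU.
  apply: IH; split=> [J J' JJ'|I H X IHX]; first by apply/fN/rneg_right.
  by apply/fI/rihx_right.
- rewrite -[bracket _ _]/(bracket_l r x).
  move: x; apply: freeg_ind => [|y y' Hy Hy'|A].
  + by rewrite !raddf0.
  + by rewrite !raddfB /= Hy Hy' subr0.
  rewrite /bracket_l -[bracket _ _]/(bracket_r << A >> r).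
  rewrite -/((flift f \o bracket_r <<A>>) r).
  rewrite (@eq_freeg_additive _ _ (flift f \o bracket_r <<A>>) (flift (fun B => f (Node B A)))); last first.
    by move=> k /=; rewrite /bracket_r bracketUl !fliftU.
  apply: IH; split=> [J J' JJ'|I H X IHX]; first by apply/fN/rneg_left.
  by apply/fI/rihx_left.
Qed.

Definition qlift (G : zmodType) (f : rtree -> G) (fL : lie_compat f) : L -> G :=
  zlift (fun r => @quasi_lie_rel_flift G f r fL).
HB.instance Definition _ (G : zmodType) (f : rtree -> G) (fL : lie_compat f) :=
  GRing.Additive.on (qlift fL).

Lemma qliftE (G : zmodType) (f : rtree -> G) (fL : lie_compat f) J :
  qlift fL (tr J) = f J.
Proof. by rewrite /qlift zliftE /= fliftU. Qed.

Lemma zpi_bracket_r (x r : {freeg rtree}) :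
  zpi (@quasi_lie_rel m) r = 0 -> zpi (@quasi_lie_rel m) (bracket x r) = 0.
Proof.
move/zpi_eq0; elim=> {r} [r rel||r r' _ IH _ IH'].
- by apply: zpi_rel; apply: ql_idealr.
- by rewrite -[bracket x 0]/(bracket_l x 0) !raddf0.
- by rewrite bracketBr raddfB /= IH IH' subr0.
Qed.

Lemma zpi_bracket_l (x r : {freeg rtree}) :
  zpi (@quasi_lie_rel m) r = 0 -> zpi (@quasi_lie_rel m) (bracket r x) = 0.
Proof.
move/zpi_eq0; elim=> {r} [r rel||r r' _ IH _ IH'].
- by apply: zpi_rel; apply: ql_ideall.
- by rewrite -[bracket 0 x]/(bracket_r x 0) !raddf0.
- by rewrite bracketBl raddfB /= IH IH' subr0.
Qed.

(** Conversely the tree relations hold in the quasi-Lie algebra, so it is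
    presented by them. *)
Lemma tr_compat : lie_compat tr.
Proof.
split=> [J J'|I H X].
- elim=> {J J'} [A B|A A' B _ IH|A B B' _ IH].
  + by rewrite /tr -raddfD /= -!bracketUl; apply/zpi_rel/ql_antisym.
  + move: IH; rewrite /tr -!raddfD /= => /(zpi_bracket_l << B >>).
    by rewrite -[bracket _ _]/(bracket_r <<B>> _) raddfD /= /bracket_r !bracketUl.
  + move: IH; rewrite /tr -!raddfD /= => /(zpi_bracket_r << A >>).
    by rewrite -[bracket _ _]/(bracket_l <<A>> _) raddfD /= /bracket_l !bracketUl.
- elim=> {I H X} [A B C|I H X B _ IH|A I H X _ IH].
  + have N J K : tr (Node J K) = - tr (Node K J).
      apply/eqP; rewrite -addr_eq0 /tr -raddfD /= -!bracketUl.
      by apply/eqP/zpi_rel/ql_antisym.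
    rewrite (N (Node A B)) (N (Node A C)) opprK.
    have -> : - tr (Node B (Node A C)) = tr (Node B (Node C A)).
      apply/esym/eqP; rewrite -addr_eq0 /tr -raddfD /=.
      rewrite -!(bracketUl B) -!/(bracket_l <<B>> _) -raddfD /= zpi_bracket_r //.
      by rewrite -!bracketUl; apply/zpi_rel/ql_antisym.
    rewrite addrAC /tr -!raddfD /= -!bracketUl; apply/zpi_rel/ql_jacobi.
  + move: IH; rewrite /tr -raddfB -!raddfD /= => /(zpi_bracket_l << B >>).
    rewrite -[bracket _ _]/(bracket_r <<B>> _) raddfD raddfB /= /bracket_r.
    by rewrite !bracketUl raddfD raddfB.
  + move: IH; rewrite /tr -raddfB -!raddfD /= => /(zpi_bracket_r << A >>).
    rewrite -[bracket _ _]/(bracket_l <<A>> _) raddfD raddfB /= /bracket_l.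
    by rewrite !bracketUl raddfD raddfB.
Qed.

Section BilinearLift.
Variables (G : zmodType) (b : rtree -> rtree -> G).
Hypotheses (bl : forall B, lie_compat (b^~ B)) (br : forall A, lie_compat (b A)).

(** Two trees are paired through a representative of the first argument: that
    the result does not depend on it is [bliftE]. *)
Definition blift (bl : forall B, lie_compat (b^~ B))
  (br : forall A, lie_compat (b A)) (x y : L) : G :=
  flift (fun A => qlift (br A) y) (repr x).

Lemma blift_compat y : lie_compat (fun A => qlift (br A) y).
Proof.
split=> [J J' JJ'|I H X IHX].
- move: y; apply: qlie_ind => [|y y' Hy Hy'|B]; first by rewrite !raddf0 addr0.
    by rewrite !raddfB /= addrACA Hy -opprD Hy' subr0.
  by rewrite !qliftE; apply: (bl B).1.
- move: y; apply: qlie_ind => [|y y' Hy Hy'|B]; first by rewrite !raddf0 !addr0.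
    rewrite !raddfB /=.
    transitivity ((qlift (br I) y - qlift (br H) y + qlift (br X) y) -
       (qlift (br I) y' - qlift (br H) y' + qlift (br X) y')); last by rewrite Hy Hy' subr0.
    by rewrite !opprD [RHS]addrACA; congr (_ + _); rewrite [RHS]addrACA.
  by rewrite !qliftE; apply: (bl B).2.
Qed.

Lemma bliftE x y : blift bl br x y = qlift (blift_compat y) x.
Proof. by []. Qed.

Lemma blift_tr A y : blift bl br (tr A) y = qlift (br A) y.
Proof. by rewrite bliftE qliftE. Qed.

Lemma blift_trtr A B : blift bl br (tr A) (tr B) = b A B.
Proof. by rewrite blift_tr qliftE. Qed.

Lemma bliftBl x x' y : blift bl br (x - x') y = blift bl br x y - blift bl br x' y.
Proof. by rewrite !bliftE raddfB. Qed.

Lemma blift_is_zmod_morphism x : zmod_morphism (blift bl br x).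
Proof.
move=> y y'; move: x; apply: qlie_ind => [|x x' Hx Hx'|A].
- by rewrite !bliftE !raddf0 addr0.
- by rewrite !bliftBl Hx Hx' !opprD addrACA.
- by rewrite !blift_tr raddfB.
Qed.

HB.instance Definition _ x := GRing.isZmodMorphism.Build L G (blift bl br x)
  (blift_is_zmod_morphism x).

Definition blift_r y x := blift bl br x y.
Lemma blift_r_is_zmod_morphism y : zmod_morphism (blift_r y).
Proof. by move=> x x'; apply: bliftBl. Qed.
HB.instance Definition _ y := GRing.isZmodMorphism.Build L G (blift_r y)
  (blift_r_is_zmod_morphism y).

End BilinearLift.

End QuasiLieTheory.

(** * Walks in unitrivalent trees *)

Section Walks.
Variables (m : nat) (t : ribbon m).
Hypothesis t_tree : is_tree t.
Implicit Types d e h v : halfedge t.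
Notation walk := (connect (@walk_step m t)).

Lemma mateK d : mate (mate d) = d.
Proof. by case/and5P: t_tree => _ /forallP/(_ d)/andP[_ /eqP]. Qed.

Lemma mate_neq d : mate d != d.
Proof. by case/and5P: t_tree => _ /forallP/(_ d)/andP[]. Qed.

Lemma turn_inj : injective (turn t).
Proof. exact: perm_inj. Qed.

Lemma trivalent d : ~~ univalent d ->
  [/\ turn t (turn t (turn t d)) = d, turn t (turn t d) != d &
      forall e, (e \in porbit (turn t) d) = (e \in [:: d; turn t d; turn t (turn t d)])].
Proof.
rewrite /univalent => dN; case/and5P: t_tree => _ _ /forall_inP/(_ (porbit (turn t) d)) H _ _.
have /H/orP[/eqP D|/eqP D] : porbit (turn t) d \in porbits (turn t) by apply: imset_f.
  by have := iter_porbit (turn t) d; rewrite D /= => /eqP; rewrite (negPf dN).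
have := iter_porbit (turn t) d; have := uniq_traject_porbit (turn t) d.
have := porbit_traject (turn t) d; rewrite D /=.
by move=> E /and3P[]; rewrite !inE negb_or => /andP[_ ne] _ _ ?; rewrite eq_sym.
Qed.

Lemma turnK3 d : turn t (turn t (turn t d)) = d.
Proof.
have [/eqP dE|/trivalent[]//] := boolP (univalent d).
by rewrite !dE.
Qed.

Lemma univalent_turn d : univalent (turn t d) = univalent d.
Proof. by rewrite /univalent (inj_eq turn_inj). Qed.

Lemma walk_step_rev d e : walk_step d e -> walk_step (mate e) (mate d).
Proof.
by rewrite /walk_step mateK porbit_sym => /andP[-> /=]; rewrite eq_sym.
Qed.

Lemma walk_rev d e : walk d e -> walk (mate e) (mate d).
Proof.
case/connectP=> p; elim: p d => [|x p IH] d /=; first by move=> _ ->.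
case/andP=> dx xp eE; apply: connect_trans (IH _ xp eE) _.
exact/connect1/walk_step_rev.
Qed.

Lemma no_cycle d e : walk_step d e -> ~~ walk e d.
Proof. by case/and5P: t_tree => _ _ _ _ /forallP/(_ d)/forallP/(_ e)/implyP. Qed.

Lemma walk_step_turn d : ~~ univalent d -> walk_step (mate d) (turn t d).
Proof.
by move=> dN; rewrite /walk_step mateK dN -[turn t d]/((turn t ^+ 1)%g d) mem_porbit.
Qed.

Lemma walk_step_turn2 d : ~~ univalent d -> walk_step (mate d) (turn t (turn t d)).
Proof.
move=> /trivalent[_ dN E]; rewrite /walk_step mateK dN E.
by rewrite !inE eqxx !orbT.
Qed.

(** A walk that comes back along the edge it started from would contain a
    closed walk in its middle: strip equal ends until it fails to fold. *)
Lemma no_reverse d : ~~ walk d (mate d).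
Proof.
apply/negP => /connectP[p]; have [k] := ubnP (size p).
elim: k d p => // k IH d [|x p] /=; first by move=> _ _ /eqP; rewrite (negPf (mate_neq d)).
rewrite ltnS => pk /andP[dx].
elim/last_ind: p pk => [|q y _] /=.
  by move=> _ _ xE; move: dx; rewrite /walk_step xE eqxx andbF.
rewrite size_rcons rcons_path last_rcons => pk /andP[xq yx] yE.
have [xE|xN] := eqVneq x (mate (last x q)).
  by apply: (IH x q) (ltnW pk) xq _; rewrite {1}xE mateK.
have : walk_step (last x q) x.
  rewrite /walk_step xN andbT; case/andP: dx => /porbitP[i xi] _.
  rewrite {1}xi yE; case/andP: yx=> /porbitP[j ->] _.
  by rewrite -permM -expgD mem_porbit.
move/no_cycle/negP; apply; apply/connectP; by exists q.
Qed.

(** Walks of positive length: these, unlike [connect], cannot be closed. *)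
Definition walk1 d e := exists2 s, walk_step d s & walk s e.

Lemma walk1W d e : walk1 d e -> walk d e.
Proof. by case=> s ds se; apply: connect_trans se; apply: connect1. Qed.

Lemma walk1_trans d e h : walk1 d e -> walk e h -> walk1 d h.
Proof. by case=> s ds se eh; exists s => //; apply: connect_trans eh. Qed.

Lemma walk_trans1 d e h : walk d e -> walk1 e h -> walk1 d h.
Proof.
case/connectP=> [[|x p]] /=; first by move=> _ ->.
case/andP=> dx xp eE eh; exists x => //; apply: connect_trans (walk1W eh).
by apply/connectP; exists p.
Qed.

Lemma walk1_rev d e : walk1 d e -> walk1 (mate e) (mate d).
Proof.
case=> s /walk_step_rev ds /walk_rev se; apply: walk_trans1 se _.
by exists (mate d).
Qed.

Lemma no_cycle1 d : ~ walk1 d d.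
Proof. by case=> s /no_cycle/negP. Qed.

End Walks.

(** * Half-edges of a glued pair of rooted trees *)

Section HalfEdges.
Variable m : nat.

(** The half-edges of a rooted tree: one at each leaf, and three at each inner
    vertex, where [None] points to the root and [Some b] to a child.  They are
    indexed by positions rather than by numbers so that every construction is a
    structural recursion on the tree. *)
Fixpoint he (I : rtree m) : finType :=
  match I with
  | Leaf _ => unit
  | Node A B => (option bool + (he A + he B))%type
  end.

Definition he_root I : he I :=
  match I with Leaf _ => tt | Node A B => inl None end.

Fixpoint he_turn I : he I -> he I :=
  match I with
  | Leaf _ => id
  | Node A B => fun x => match x with
    | inl None => inl (Some false)
    | inl (Some false) => inl (Some true)
    | inl (Some true) => inl None
    | inr (inl y) => inr (inl (he_turn y))
    | inr (inr y) => inr (inr (he_turn y))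
    end
  end.

(** [None] stands for the other half of the root edge. *)
Fixpoint he_mate I : he I -> option (he I) :=
  match I with
  | Leaf _ => fun _ => None
  | Node A B => fun x => match x with
    | inl None => None
    | inl (Some false) => Some (inr (inl (he_root A)))
    | inl (Some true) => Some (inr (inr (he_root B)))
    | inr (inl y) => Some (if he_mate y is Some z then inr (inl z) else inl (Some false))
    | inr (inr y) => Some (if he_mate y is Some z then inr (inr z) else inl (Some true))
    end
  end.

(** Only leaves carry labels; the value at an inner vertex is arbitrary. *)
Fixpoint he_label I : he I -> 'I_m :=
  match I with
  | Leaf i => fun _ => i
  | Node A B => fun x => match x with
    | inl _ => he_label (he_root A)
    | inr (inl y) => he_label y
    | inr (inr y) => he_label y
    end
  end.

(** Rooted trees are connected. *)
Lemma he_ind I (P : he I -> Prop) : P (he_root I) ->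
  (forall x, P x -> P (he_turn x)) ->
  (forall x y, he_mate x = Some y -> P x -> P y) -> forall x, P x.
Proof.
elim: I P => [i|A IA B IB] P Pr Pt Pm; first by case.
have PS b : P (inl (Some b)) by case: b; do ?apply: (Pt _ Pr); apply: (Pt _ (Pt _ Pr)).
case=> [[b|]|[]]; [exact: PS|exact: Pr| |].
- apply: IA => [|x /Pt//|x y xy]; first exact: (Pm _ _ _ (PS false)).
  by apply: Pm; rewrite /= xy.
- apply: IB => [|x /Pt//|x y xy]; first exact: (Pm _ _ _ (PS true)).
  by apply: Pm; rewrite /= xy.
Qed.

Lemma he_mate_root I : he_mate (he_root I) = None.
Proof. by case: I. Qed.

Lemma he_mate_None I (x : he I) : he_mate x = None -> x = he_root I.
Proof. by case: I x => [i []|A B] //= [[[]|]|[]]. Qed.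

Lemma he_mateK I (x y : he I) : he_mate x = Some y -> he_mate y = Some x.
Proof.
elim: I x y => [//|A IA B IB] [[[]|]|[x|x]] y //= [<-] /=; rewrite ?he_mate_root //.
- by case E: (he_mate x) => [z|] /=; rewrite ?(IA _ _ E) // (he_mate_None E).
- by case E: (he_mate x) => [z|] /=; rewrite ?(IB _ _ E) // (he_mate_None E).
Qed.

Lemma he_mate_neq I (x : he I) : he_mate x <> Some x.
Proof.
elim: I x => [//|A IA B IB] [[[]|]|[x|x]] //=.
  by case E: (he_mate x) => [z|] //= [] zx; apply: (IA x); rewrite E zx.
by case E: (he_mate x) => [z|] //= [] zx; apply: (IB x); rewrite E zx.
Qed.

Lemma he_turnK3 I (x : he I) : he_turn (he_turn (he_turn x)) = x.
Proof.
elim: I x => [//|A IA B IB] [[[]|]|[x|x]] //=; by rewrite ?IA ?IB.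
Qed.

Variables I J : rtree m.

Definition ghe : finType := (he I + he J)%type.

Definition gturn (x : ghe) : ghe :=
  match x with inl y => inl (he_turn y) | inr y => inr (he_turn y) end.

Definition gmate (x : ghe) : ghe :=
  match x with
  | inl y => if he_mate y is Some z then inl z else inr (he_root J)
  | inr y => if he_mate y is Some z then inr z else inl (he_root I)
  end.

Definition glabel (x : ghe) : 'I_m :=
  match x with inl y => he_label y | inr y => he_label y end.

Lemma gmateK : involutive gmate.
Proof.
case=> x /=; case E: (he_mate x) => [y|] /=; rewrite ?(he_mateK E) //;
by rewrite he_mate_root (he_mate_None E).
Qed.

Lemma gmate_neq x : gmate x != x.
Proof.
by apply/eqP; case: x => x /=; case E: (he_mate x) => [y|] //= [] yx;
  apply: (@he_mate_neq _ x); rewrite E yx.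
Qed.

Lemma gturnK3 x : gturn (gturn (gturn x)) = x.
Proof. by case: x => x /=; rewrite he_turnK3. Qed.

Lemma gturn_inj : injective gturn.
Proof. by apply: (@can_inj _ _ _ (gturn \o gturn)) => x /=; rewrite gturnK3. Qed.

Lemma ghe_ind (P : ghe -> Prop) : P (inl (he_root I)) ->
  (forall x, P x -> P (gturn x)) -> (forall x, P x -> P (gmate x)) ->
  forall x, P x.
Proof.
move=> Pr Pt Pm; have Pr' : P (inr (he_root J)).
  by have := Pm _ Pr; rewrite /= he_mate_root.
case=> x; move: x; apply: he_ind => //.
- by move=> x /Pt.
- by move=> x y xy /Pm /=; rewrite xy.
- by move=> x /Pt.
- by move=> x y xy /Pm /=; rewrite xy.
Qed.

End HalfEdges.

(** * The half-edges of a tree cut along an edge *)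

Section Unfold.
Variables (m : nat) (t : ribbon m).
Hypothesis t_tree : is_tree t.
Implicit Types d e h v : halfedge t.
Notation walk := (connect (@walk_step m t)).

(** The half-edges of [t] found by following the shape of [I] from [d] on; this
    identifies [he I] with the part of [t] behind [d] when [subtree d I] holds. *)
Fixpoint unfold (I : rtree m) : halfedge t -> he I -> halfedge t :=
  match I return halfedge t -> he I -> halfedge t with
  | Leaf _ => fun d _ => d
  | Node A B => fun d x => match x with
    | inl None => d
    | inl (Some false) => turn t d
    | inl (Some true) => turn t (turn t d)
    | inr (inl y) => unfold (mate (turn t d)) y
    | inr (inr y) => unfold (mate (turn t (turn t d))) y
    end
  end.

Lemma unfold_root I d : unfold d (he_root I) = d.
Proof. by case: I. Qed.

Lemma unfold_turn d I : subtree d I ->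
  forall x : he I, unfold d (he_turn x) = turn t (unfold d x).
Proof.
elim=> {d I} [d /eqP //|d A B dN _ IA _ IB] [[[]|]|[x|x]] //=.
by rewrite turnK3.
Qed.

Lemma unfold_mate d I : subtree d I -> forall x : he I,
  mate (unfold d x) = if he_mate x is Some y then unfold d y else mate d.
Proof.
elim=> {d I} [d //|d A B dN _ IA _ IB] [[[]|]|[x|x]] //=.
- by rewrite unfold_root.
- by rewrite unfold_root.
- by rewrite IA; case: (he_mate x) => //=; rewrite mateK.
- by rewrite IB; case: (he_mate x) => //=; rewrite mateK.
Qed.

Lemma unfold_univalent d I : subtree d I -> forall x : he I,
  univalent (unfold d x) = (he_turn x == x).
Proof.
elim=> {d I} [d /eqP dE|d A B dN _ IA _ IB] [].
- by rewrite /univalent dE !eqxx.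
- by move=> [[]|] /=; rewrite ?univalent_turn //; exact/negbTE.
- by case=> x /=; rewrite ?IA ?IB.
Qed.

Lemma unfold_label d I : subtree d I -> forall x : he I,
  he_turn x = x -> leaf_label (unfold d x) = he_label x.
Proof.
elim=> {d I} [d //|d A B dN _ IA _ IB] [[[]|]|[x|x]] //= [].
- exact: IA.
- exact: IB.
Qed.

(** A half-edge [h] lies on the far side of [d] if the walk from [d] reaches it
    either pointing away from [d], or, reversed, pointing back to [d]. *)
Definition beyond d h := walk d (mate h) \/ walk1 d h.

Lemma beyondW d h : beyond d h -> walk d (mate h) \/ walk d h.
Proof. by case=> [|/walk1W]; [left|right]. Qed.

(** Two walks that leave a vertex along different edges never meet again, in
    either direction: reversing one of them would close the other up. *)
Lemma beyond_disjoint d e h : e \in porbit (turn t) d -> e != d ->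
  beyond d h -> ~ beyond e h.
Proof.
move=> ed eNd.
have s : walk_step (mate e) d by rewrite /walk_step mateK // porbit_sym ed eq_sym.
have X k : walk d k -> ~ walk e k.
  move=> dk /(walk_rev t_tree) ke; case/negP: (no_reverse t_tree (mate k)).
  rewrite mateK //; apply: connect_trans ke _; exact: connect_trans (connect1 s) _.
have Y k : walk d k -> ~ walk e (mate k).
  move=> dk /(walk_rev t_tree); rewrite mateK // => ke.
  by apply: (no_cycle1 t_tree (d := k)); apply: walk_trans1 ke _; exists d.
move=> /beyondW[] dh /beyondW[] eh; first exact: (X _ dh).
- by apply: (Y _ dh); rewrite mateK.
- exact: (Y _ dh).
- exact: (X _ dh).
Qed.

Lemma beyond_vertex d h : h \in porbit (turn t) d -> ~ beyond d h.
Proof.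
move=> hd; have [->|hNd] := eqVneq h d.
  by case; [move=> /(negP (no_reverse t_tree d))|apply: no_cycle1].
case=> [dh|/(walk1_rev t_tree) hd1].
- apply: (no_cycle1 t_tree (d := mate h)); exists d => //.
  by rewrite /walk_step mateK // porbit_sym hd eq_sym.
- case/negP: (no_reverse t_tree (mate h)); rewrite mateK //.
  apply: connect_trans (walk1W hd1) _; apply: connect1.
  by rewrite /walk_step mateK // hd.
Qed.

Lemma beyond_opposite d h : beyond (mate d) h -> ~ beyond d h.
Proof.
case=> [/(walk_rev t_tree)|/(walk1_rev t_tree)]; rewrite !mateK // => hd [dh|dh].
- by case/negP: (no_reverse t_tree h); apply: connect_trans hd _.
- by apply: (no_cycle1 t_tree (d := h)); apply: walk_trans1 hd _.
- by apply: (no_cycle1 t_tree (d := mate h)); apply: walk1_trans hd _.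
- case/negP: (no_reverse t_tree (mate h)); rewrite mateK //.
  by apply: connect_trans (walk1W hd) (walk1W dh).
Qed.

Lemma unfold_beyond d I : subtree d I -> forall x : he I, beyond (mate d) (unfold d x).
Proof.
elim=> {d I} [d|d A B dN _ IA _ IB]; first by left.
have s1 := walk_step_turn t_tree dN; have s2 := walk_step_turn2 t_tree dN.
case=> [[[]|]|[x|x]] /=.
- by right; exists (turn t (turn t d)).
- by right; exists (turn t d).
- by left.
- have := IA x; rewrite mateK // => -[?|?].
    by left; apply: connect_trans (connect1 s1) _.
  by right; apply: walk_trans1 (connect1 s1) _.
- have := IB x; rewrite mateK // => -[?|?].
    by left; apply: connect_trans (connect1 s2) _.
  by right; apply: walk_trans1 (connect1 s2) _.
Qed.

(** Two positions with the same half-edge would give two walks from one vertex,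
    along different edges, that meet again. *)
Lemma unfold_inj d I : subtree d I -> injective (@unfold I d).
Proof.
elim=> {d I} [d _ [] []//|d A B dN sA IA sB IB].
have [t3 t2 E] := trivalent t_tree dN.
have bA x : beyond (turn t d) (@unfold A (mate (turn t d)) x).
  by have := unfold_beyond sA x; rewrite mateK.
have bB x : beyond (turn t (turn t d)) (@unfold B (mate (turn t (turn t d))) x).
  by have := unfold_beyond sB x; rewrite mateK.
have orb e h : e \in [:: d; turn t d; turn t (turn t d)] ->
    h \in [:: d; turn t d; turn t (turn t d)] -> h \in porbit (turn t) e.
  rewrite -!E => ed hd; move: hd; rewrite -!eq_porbit_mem => /eqP ->.
  by rewrite eq_sym eq_porbit_mem.
have vA o (x : he A) : unfold d (inl o : he (Node A B)) <> unfold (mate (turn t d)) x.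
  move=> ox; apply: (@beyond_vertex (turn t d) _ _ (bA x)); rewrite -ox.
  by apply: orb; case: o {ox} => [[]|] /=; rewrite !inE eqxx ?orbT.
have vB o (x : he B) : unfold d (inl o : he (Node A B)) <> unfold (mate (turn t (turn t d))) x.
  move=> ox; apply: (@beyond_vertex (turn t (turn t d)) _ _ (bB x)); rewrite -ox.
  by apply: orb; case: o {ox} => [[]|] /=; rewrite !inE eqxx ?orbT.
have AB (x : he A) (y : he B) : unfold (mate (turn t d)) x <> @unfold B (mate (turn t (turn t d))) y.
  move=> xy; apply: (@beyond_disjoint (turn t d) (turn t (turn t d)) _ _ _ (bA x)).
  - by apply: orb; rewrite !inE eqxx ?orbT.
  - by rewrite (inj_eq perm_inj) -[_ == _]/(univalent d).
  - by rewrite xy.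
have dN' : (turn t d == d) = false by exact: negbTE.
case=> [o|[x|x]] [o'|[y|y]] //; rewrite -?[unfold d (inr _)]/(unfold _ _).
- case: o o' => [[]|] [[]|] //= /eqP; rewrite ?(inj_eq perm_inj) ?(negPf t2) ?dN' //;
  by rewrite eq_sym ?(inj_eq perm_inj) ?(negPf t2) ?dN'.
- by move/vA.
- by move/vB.
- by move/esym/vA.
- by move/IA ->.
- by move/AB.
- by move/esym/vB.
- by move/esym/AB.
- by move/IB ->.
Qed.

Variables (I J : rtree m) (d : halfedge t).
Hypotheses (dI : subtree d I) (dJ : subtree (mate d) J).

Definition gunfold (x : ghe I J) : halfedge t :=
  match x with inl y => unfold d y | inr y => unfold (mate d) y end.

Lemma gunfold_turn x : gunfold (gturn x) = turn t (gunfold x).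
Proof. by case: x => x /=; rewrite unfold_turn. Qed.

Lemma gunfold_mate x : gunfold (gmate x) = mate (gunfold x).
Proof.
by case: x => x /=; rewrite (unfold_mate dI, unfold_mate dJ);
  case: (he_mate x) => //=; rewrite unfold_root ?mateK.
Qed.

Lemma gunfold_univalent x : univalent (gunfold x) = (gturn x == x).
Proof. by case: x => x /=; rewrite (unfold_univalent dI, unfold_univalent dJ). Qed.

Lemma gunfold_label x : gturn x = x -> leaf_label (gunfold x) = glabel x.
Proof. by case: x => x /= []; apply: unfold_label. Qed.

Lemma gunfold_inj : injective gunfold.
Proof.
have D (x : he I) (y : he J) : unfold d x <> unfold (mate d) y.
  move=> xy; apply: (beyond_opposite (unfold_beyond dI x)).
  by rewrite xy; have := unfold_beyond dJ y; rewrite mateK.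
case=> x [] y /= xy; first by rewrite (unfold_inj dI xy).
- by case: (D _ _ xy).
- by case: (D _ _ (esym xy)).
- by rewrite (unfold_inj dJ xy).
Qed.

Lemma gunfold_surj h : exists x, gunfold x = h.
Proof.
case/and5P: t_tree => _ _ _ /forallP/(_ d)/forallP/(_ h) + _.
case/connectP=> p dp ->.
suff: forall c, (exists x, gunfold x = c) ->
    path (fun x y : halfedge t => (y == mate x) || (y == turn t x)) c p ->
    exists x, gunfold x = last c p.
  by apply=> //; exists (inl (he_root I)); rewrite /= unfold_root.
elim: p {dp} => [|e p IH] c //= [x <-] /andP[ce ep]; apply: IH ep.
case/orP: ce => /eqP ->; [exists (gmate x)|exists (gturn x)].
  exact: gunfold_mate.
exact: gunfold_turn.
Qed.

(** Injective because a tree has no closed walk, surjective because it is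
    connected. *)
Lemma gunfold_bij : bijective gunfold.
Proof.
have S h : exists x, gunfold x == h by have [x <-] := gunfold_surj h; exists x.
have invK h : gunfold (xchoose (S h)) = h := eqP (xchooseP (S h)).
by exists (fun h => xchoose (S h)) => // x; apply: gunfold_inj; rewrite invK.
Qed.

End Unfold.

(** * Existence and uniqueness of glued trees *)

Section Subtrees.
Variable m : nat.

Lemma subtree_fun (t : ribbon m) (d : halfedge t) I J :
  subtree d I -> subtree d J -> I = J.
Proof.
move=> dI; elim: dI J => {d I} [d du|d A B dN _ IA _ IB] J dJ.
  by case: dJ du => {d J} // d A B /negPf ->.
case: dJ dN IA IB => {d J} [d -> //|d A' B' _ dA dB _ IA IB].
by rewrite (IA _ dA) (IB _ dB).
Qed.

(** The recursion ends because each step leaves the vertex behind, so that fewer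
    half-edges remain within reach. *)
Lemma subtree_exists (t : ribbon m) (d : halfedge t) : is_tree t -> exists J, subtree d J.
Proof.
move=> tt; have [k] := ubnP #|connect (@walk_step m t) (mate d)|.
elim: k d => // k IH d; rewrite ltnS => dk.
have [du|dN] := boolP (univalent d); first by exists (Leaf (leaf_label d)); left.
have H e : walk_step (mate d) e -> exists J, subtree (mate e) J.
  move=> de; apply: IH; apply: leq_trans dk; rewrite mateK //.
  apply/proper_card/properP; split.
    by apply/subsetP => x; rewrite !inE; apply/connect_trans/connect1.
  by exists (mate d); rewrite inE ?connect0 //; apply: no_cycle.
have [A dA] := H _ (walk_step_turn tt dN); have [B dB] := H _ (walk_step_turn2 tt dN).
by exists (Node A B); right.
Qed.

Lemma glued_sym (t : ribbon m) I J : is_tree t -> glued t I J -> glued t J I.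
Proof. by move=> tt [d dI dJ]; exists (mate d); rewrite ?mateK. Qed.

Lemma subtree_NodeP (t : ribbon m) (d : halfedge t) A B : subtree d (Node A B) ->
  [/\ ~~ univalent d, subtree (mate (turn t d)) A & subtree (mate (turn t (turn t d))) B].
Proof.
move=> dAB; move E: (Node A B) dAB => I dI.
by case: dI E => // {}d A' B' ? ? ? [-> ->].
Qed.

Lemma subtree_LeafP (t : ribbon m) (d : halfedge t) i : subtree d (Leaf i) ->
  univalent d /\ leaf_label d = i.
Proof.
move=> di; move E: (Leaf i) di => I dI.
by case: dI E => // {}d ? [->].
Qed.

(** The edge at which a tree is cut may be moved across a vertex. *)
Lemma subtree_turn (t : ribbon m) (d : halfedge t) A B C : is_tree t ->
  subtree d (Node A B) -> subtree (mate d) C -> subtree (turn t d) (Node B C).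
Proof.
move=> tt /subtree_NodeP[dN dA dB] dC; right; rewrite ?univalent_turn //.
by rewrite turnK3.
Qed.

Lemma glued_move (t : ribbon m) A B C : is_tree t ->
  glued t (Node A B) C -> glued t A (Node B C).
Proof.
move=> tt [d dAB dC]; have [_ dA _] := subtree_NodeP dAB.
by exists (mate (turn t d)) => //; rewrite mateK //; exact: subtree_turn dAB dC.
Qed.

End Subtrees.

Section Isomorphisms.
Variable m : nat.
Implicit Types t : ribbon m.

(** A tree is determined by its two parts at any edge: both trees are identified
    with the half-edges of [I] and [J]. *)
Lemma glued_iso t t' I J : is_tree t -> is_tree t' -> glued t I J -> glued t' I J ->
  tree_iso t t'.
Proof.
move=> tt tt' [d dI dJ] [d' dI' dJ'].
have [inv Kinv invK] := gunfold_bij tt dI dJ.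
have bij' := gunfold_bij tt' dI' dJ'.
exists (gunfold (I := I) (J := J) d' \o inv).
split=> [|h|h hu|h] /=.
- by apply: bij_comp => //; exists (gunfold d).
- by rewrite -{1}(invK h) -gunfold_mate // Kinv gunfold_mate.
- have fx : gturn (inv h) = inv h by apply/eqP; rewrite -(gunfold_univalent dI dJ) invK.
  by rewrite (gunfold_label dI' dJ') // -(gunfold_label dI dJ) // invK.
- by rewrite inE -{1}(invK h) -gunfold_turn // Kinv gunfold_turn.
Qed.

Definition gswap (A B C : rtree m) (x : ghe (Node A B) C) : ghe (Node B A) C :=
  match x with
  | inl (inl o) => inl (inl (omap negb o))
  | inl (inr (inl y)) => inl (inr (inr y))
  | inl (inr (inr y)) => inl (inr (inl y))
  | inr y => inr y
  end.

Lemma gswapK (A B C : rtree m) : cancel (@gswap A B C) (@gswap B A C).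
Proof. by case=> [[[[]|]|[]]|]. Qed.

Lemma gswap_mate (A B C : rtree m) (x : ghe (Node A B) C) :
  gswap (gmate x) = gmate (gswap x).
Proof. by case: x => [[[[]|]|[x|x]]|x] //=; case: (he_mate x). Qed.

Lemma gswap_turn (A B C : rtree m) (x : ghe (Node A B) C) :
  if x is inl (inl _) then gturn (gswap (gturn x)) = gswap x
  else gswap (gturn x) = gturn (gswap x).
Proof. by case: x => [[[[]|]|[x|x]]|x]. Qed.

Lemma gswap_label (A B C : rtree m) (x : ghe (Node A B) C) :
  gturn x = x -> glabel (gswap x) = glabel x.
Proof. by case: x => [[[[]|]|[x|x]]|x]. Qed.

Lemma glued_reversed t t' A B C : is_tree t -> is_tree t' ->
  glued t (Node A B) C -> glued t' (Node B A) C -> one_reversed t t'.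
Proof.
move=> tt tt' [d dI dJ] [d' dI' dJ'].
have [inv Kinv invK] := gunfold_bij tt dI dJ.
have bij' := gunfold_bij tt' dI' dJ'.
have ibij : bijective inv by exists (@gunfold m t (Node A B) C d).
have [dN _ _] := subtree_NodeP dI.
exists d => //.
exists (gunfold (I := Node B A) (J := C) d' \o (@gswap A B C \o inv)).
split=> [|h|h hu|h] /=.
- apply: bij_comp => //; apply: bij_comp ibij.
  by exists (@gswap B A C); apply: gswapK.
- by rewrite -{1}(invK h) -gunfold_mate // Kinv gswap_mate gunfold_mate.
- have fx : gturn (inv h) = inv h by apply/eqP; rewrite -(gunfold_univalent dI dJ) invK.
  have fx' : gturn (gswap (inv h)) = gswap (inv h).
    have := gswap_turn (inv h); rewrite fx.
    by case: (inv h) fx => [[[[]|]|[x|x]]|x].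
  by rewrite (gunfold_label dI' dJ') // gswap_label // -(gunfold_label dI dJ) // invK.
- rewrite -{1 2}(invK h) -gunfold_turn // Kinv.
  have -> : (gunfold d (inv h) \in porbit (turn t) d) =
      if inv h is inl (inl _) then true else false.
    have [_ _ ->] := trivalent tt dN.
    have inj := gunfold_inj tt dI dJ.
    have D0 : gunfold d (inl (inl None) : ghe (Node A B) C) = d by [].
    have D1 : gunfold d (inl (inl (Some false)) : ghe (Node A B) C) = turn t d by [].
    have D2 : gunfold d (inl (inl (Some true)) : ghe (Node A B) C) = turn t (turn t d) by [].
    rewrite -[in X in _ \in X]D1 -D2 -{2}D0 !inE !(inj_eq inj).
    by case: (inv h) => [[[[]|]|[x|x]]|x].
  have := gswap_turn (inv h); case: (inv h) => [[o|x]|x] E; last 2 first.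
  + by rewrite E gunfold_turn.
  + by rewrite E gunfold_turn.
  by apply: (@turn_inj _ t'); rewrite permKV -gunfold_turn // E.
Qed.

End Isomorphisms.

Section Transport.
Variables (m : nat) (t t' : ribbon m) (S : {set halfedge t}) (f : halfedge t -> halfedge t').
Hypotheses (f_bij : bijective f) (f_mate : forall d, f (mate d) = mate (f d)).
Hypothesis f_label : forall d, univalent d -> leaf_label (f d) = leaf_label d.
Hypothesis f_turn : forall d, f (turn t d) =
  if d \in S then (turn t')^-1%g (f d) else turn t' (f d).

Lemma iso_univalent d : univalent (f d) = univalent d.
Proof.
have finj := bij_inj f_bij.
rewrite /univalent -(inj_eq finj (turn t d)) f_turn; case: (d \in S) => //.
by rewrite -(inj_eq (@perm_inj _ (turn t')) ((turn t')^-1%g (f d)) (f d)) permKV eq_sym.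
Qed.

Lemma iso_subtree d J : (forall x : he J, unfold d x \notin S) ->
  subtree d J -> subtree (f d) J.
Proof.
move=> dS dJ; elim: dJ dS => {d J} [d du|d A B dN dA IA dB IB] dS.
  by rewrite -(f_label du); left; rewrite iso_univalent.
have d0 := negPf (dS (inl None)); have d1 := negPf (dS (inl (Some false))).
rewrite /= in d0 d1.
right; rewrite ?iso_univalent //.
  have -> : mate (turn t' (f d)) = f (mate (turn t d)) by rewrite f_mate f_turn d0.
  by apply: IA => x; apply: (dS (inr (inl x))).
have -> : mate (turn t' (turn t' (f d))) = f (mate (turn t (turn t d))).
  by rewrite f_mate !f_turn d0 d1.
by apply: IB => x; apply: (dS (inr (inr x))).
Qed.

End Transport.

Lemma iso_glued m (t t' : ribbon m) I J :
  tree_iso t t' -> glued t I J -> glued t' I J.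
Proof.
case=> f [fb fm fl ft] [d dI dJ].
have H e K : subtree e K -> subtree (f e) K.
  by move=> ?; apply: (iso_subtree fb fm fl ft) => // x; rewrite inE.
by exists (f d); rewrite -?fm; apply: H.
Qed.

(** Reversing one vertex changes the cyclic order at the cut when the tree is
    cut next to that vertex, and nothing beyond the cut. *)
Lemma reversed_glued m (t t' : ribbon m) : is_tree t -> is_tree t' ->
  one_reversed t t' ->
  exists A B C, glued t (Node A B) C /\ glued t' (Node B A) C.
Proof.
move=> tt tt' [d dN [f [fb fm fl ft]]].
have [I dI] := subtree_exists d tt; have [C dC] := subtree_exists (mate d) tt.
case: I dI => [i /subtree_LeafP[du]|A B dAB]; first by rewrite du in dN.
have [_ dA dB] := subtree_NodeP dAB.
have inj := gunfold_inj tt dAB dC; have [_ _ E] := trivalent tt dN.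
(* the reversed vertex consists of the half-edges [inl (inl _)] *)
have orb (x : ghe (Node A B) C) : gunfold d x \in porbit (turn t) d ->
    if x is inl (inl _) then true else false.
  have D0 : gunfold d (inl (inl None) : ghe (Node A B) C) = d by [].
  have D1 : gunfold d (inl (inl (Some false)) : ghe (Node A B) C) = turn t d by [].
  have D2 : gunfold d (inl (inl (Some true)) : ghe (Node A B) C) = turn t (turn t d) by [].
  rewrite E -[in X in _ \in X]D1 -D2 -{2}D0 !inE !(inj_eq inj).
  by case: x => [[[[]|]|[x|x]]|x].
have fdC : subtree (mate (f d)) C.
  rewrite -fm; apply: (iso_subtree fb fm fl ft) dC => x.
  by apply/negP => /(orb (inr x)).
have fdA : subtree (f (mate (turn t d))) A.
  apply: (iso_subtree fb fm fl ft) dA => x.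
  by apply/negP => /(orb (inl (inr (inl x)))).
have fdB : subtree (f (mate (turn t (turn t d)))) B.
  apply: (iso_subtree fb fm fl ft) dB => x.
  by apply/negP => /(orb (inl (inr (inr x)))).
have dS : d \in porbit (turn t) d by rewrite porbit_id.
have dS1 : turn t d \in porbit (turn t) d by rewrite E !inE eqxx orbT.
have t1 : turn t' (f (turn t d)) = f d by rewrite ft dS permKV.
have t2 : turn t' (f (turn t (turn t d))) = f (turn t d) by rewrite ft dS1 permKV.
have t0 : turn t' (f d) = f (turn t (turn t d)).
  by rewrite -t1 -t2 turnK3.
exists A, B, C; split; first by exists d.
exists (f d) => //; right; first by rewrite (iso_univalent fb ft).
  by rewrite t0 -fm.
by rewrite t0 t2 -fm.
Qed.

(** * Counting trivalent vertices *)

Lemma card_nonunivalent m (t : ribbon m) : is_tree t ->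
  #|[set d : halfedge t | ~~ univalent d]| = (torder t * 3)%N.
Proof.
move=> tt; rewrite /torder; set P := [set A in _ | _].
have PE A : A \in P -> exists2 d : halfedge t, A = porbit (turn t) d & ~~ univalent d.
  rewrite inE => /andP[/imsetP[d _ ->] c3]; exists d => //.
  apply/negP => /eqP du; move: c3.
  have -> : porbit (turn t) d = [set d].
    apply/setP => e; rewrite inE; apply/porbitP/eqP => [[i ->]|->]; last by exists 0%N; rewrite expg0 perm1.
    by rewrite permX; elim: i => //= i ->.
  by rewrite cards1.
have cP : cover P = [set d : halfedge t | ~~ univalent d].
  apply/setP => d; rewrite inE; apply/bigcupP/idP => [[A /PE[e -> eN]]|dN].
    move=> dA; have [_ _ E] := trivalent tt eN; move: dA; rewrite E !inE.
    by case/or3P => /eqP ->; rewrite ?univalent_turn.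
  exists (porbit (turn t) d); last exact: porbit_id.
  have [_ t2 E] := trivalent tt dN.
  rewrite inE imset_f //= (eq_card E); apply/eqP.
  apply: (@card_uniqP _ [:: d; turn t d; turn t (turn t d)]).
  have dN' : turn t d != d := dN.
  by rewrite /= !inE !negb_or (inj_eq (@perm_inj _ _)) ![d == _]eq_sym t2 dN'.
apply: card_uniform_partition (P) _ _ _; first by move=> A; rewrite inE => /andP[_ /eqP].
apply/and3P; split; first exact/eqP.
- apply/trivIsetP => A B /PE[d -> _] /PE[e -> _] de; rewrite disjoints_subset.
  apply/subsetP => x xd; rewrite inE; apply: contra de => xe.
  by move: xd xe; rewrite -!eq_porbit_mem => /eqP -> .
- by apply/negP => /PE[d d0 _]; have := porbit_id (turn t) d; rewrite -d0 inE.
Qed.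

Lemma he_card m (I : rtree m) : (\sum_(x : he I | he_turn x != x) 1 = rorder I * 3)%N.
Proof.
elim: I => [i|A IA B IB] /=; first by rewrite big1 // => x; rewrite eqxx.
rewrite !big_sumType /= IA IB (eq_bigl predT); last by case=> [[]|].
by rewrite sum1_card card_option card_bool mulSn mulnDl.
Qed.

Lemma glued_torder m (t : ribbon m) I J : is_tree t -> glued t I J ->
  torder t = (rorder I + rorder J)%N.
Proof.
move=> tt [d dI dJ]; apply/eqP; rewrite -(@eqn_pmul2r 3) // -card_nonunivalent //.
rewrite -sum1_card (reindex _ (onW_bij _ (gunfold_bij tt dI dJ))) /=.
rewrite (eq_bigl (fun x => gturn x != x)); last first.
  by move=> x; rewrite inE gunfold_univalent.
by rewrite big_sumType /= !he_card mulnDl.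
Qed.

(** * Sums over univalent vertices *)

Section LeafSums.
Variables (m : nat) (G : zmodType) (g : 'I_m -> rtree m -> G).

(** The sum of [g (i(v)) (T_v)] over the leaves [v] of [I], where [T_v] is the
    tree [<I, K>] with root at [v]. *)
Fixpoint leaf_sum (I K : rtree m) : G :=
  match I with
  | Leaf i => g i K
  | Node A B => leaf_sum A (Node B K) + leaf_sum B (Node K A)
  end.

Variable t : ribbon m.
Hypothesis t_tree : is_tree t.
Variable F : halfedge t -> G.
Hypothesis Fg : forall v Tv, univalent v -> subtree (mate v) Tv -> F v = g (leaf_label v) Tv.

Lemma leaf_sumE d I K : subtree d I -> subtree (mate d) K ->
  \sum_(x : he I | he_turn x == x) F (unfold d x) = leaf_sum I K.
Proof.
move=> dI; elim: dI K => {d I} [d du|d A B dN dA IA dB IB] K dK.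
  by rewrite (big_pred1 tt) /= => [|[]//]; apply: Fg.
have dAB : subtree d (Node A B) by right.
have d1 := subtree_turn t_tree dAB dK.
have d2 : subtree (turn t (turn t d)) (Node K A) by apply: subtree_turn d1 dA.
rewrite !big_sumType /= -(IA (Node B K)) -?(IB (Node K A)) ?mateK //.
by rewrite big_pred0 ?add0r //; case=> [[]|].
Qed.

Lemma sum_univalent I J : glued t I J ->
  \sum_(v | univalent v) F v = leaf_sum I J + leaf_sum J I.
Proof.
case=> d dI dJ.
rewrite (reindex _ (onW_bij _ (gunfold_bij t_tree dI dJ))) /=.
rewrite (eq_bigl (fun x => gturn x == x)); last first.
  by move=> x; rewrite gunfold_univalent.
by rewrite big_sumType /= (leaf_sumE dI dJ) (leaf_sumE (K := I) dJ) // mateK.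
Qed.

End LeafSums.

(** * The tree glued from two rooted trees *)

Section Canonical.
Variables (m : nat) (I J : rtree m).
Notation E := (ghe I J).

Lemma conj_inj (f : E -> E) : injective f ->
  injective (fun i : 'I_#|E| => enum_rank (f (enum_val i))).
Proof. by move=> fi i j /enum_rank_inj/fi/enum_val_inj. Qed.

Definition glue : ribbon m :=
  existT _ #|E| ((perm (conj_inj (inv_inj (@gmateK m I J))), perm (conj_inj (@gturn_inj m I J))),
                 [ffun i => glabel (enum_val i)]).

Definition ghalf (x : E) : halfedge glue := enum_rank x.

Lemma ghalfP (h : halfedge glue) : exists x, ghalf x = h.
Proof. by exists (enum_val h); rewrite /ghalf enum_valK. Qed.

Lemma ghalf_inj : injective ghalf.
Proof. exact: enum_rank_inj. Qed.

Lemma mate_ghalf x : mate (ghalf x) = ghalf (gmate x).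
Proof. by rewrite /mate permE enum_rankK. Qed.

Lemma turn_ghalf x : turn glue (ghalf x) = ghalf (gturn x).
Proof. by rewrite /turn permE enum_rankK. Qed.

Lemma label_ghalf x : leaf_label (ghalf x) = glabel x.
Proof. by rewrite /leaf_label ffunE enum_rankK. Qed.

Lemma univalent_ghalf x : univalent (ghalf x) = (gturn x == x).
Proof. by rewrite /univalent turn_ghalf (inj_eq ghalf_inj). Qed.

Lemma subtree_ghalf K (phi : he K -> E) :
  (forall x, gturn (phi x) = phi (he_turn x)) ->
  (forall x y, he_mate x = Some y -> gmate (phi x) = phi y) ->
  (forall x, glabel (phi x) = he_label x) -> injective phi ->
  subtree (ghalf (phi (he_root K))) K.
Proof.
elim: K phi => [i|A IA B IB] phi ft fm fl fi.
  rewrite -[Leaf i]/(Leaf (he_label (he_root (Leaf i)))) -fl -label_ghalf.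
  by left; rewrite univalent_ghalf ft.
right; first by rewrite univalent_ghalf ft (inj_eq fi).
- rewrite turn_ghalf mate_ghalf ft (fm _ (inr (inl (he_root A)))) //.
  apply: (IA (fun x => phi (inr (inl x)))) => [x|x y xy|x|x y].
  + exact: ft.
  + by apply: fm; rewrite /= xy.
  + exact: fl.
  + by move/fi => [].
- rewrite !turn_ghalf mate_ghalf !ft (fm _ (inr (inr (he_root B)))) //.
  apply: (IB (fun x => phi (inr (inr x)))) => [x|x y xy|x|x y].
  + exact: ft.
  + by apply: fm; rewrite /= xy.
  + exact: fl.
  + by move/fi => [].
Qed.

Lemma glue_glued : glued glue I J.
Proof.
exists (ghalf (inl (he_root I))).
  by apply: (@subtree_ghalf I inl) => [||//|x y []] //= x y ->.
rewrite mate_ghalf /= he_mate_root.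
by apply: (@subtree_ghalf J inr) => [||//|x y []] //= x y ->.
Qed.

(** A potential that increases along walks: the half-edge towards the cut at
    a vertex of depth [k] has potential [- k], the other ones [k + 1]. *)
Fixpoint he_pot (K : rtree m) (k : nat) : he K -> int :=
  match K return he K -> int with
  | Leaf _ => fun _ => - k%:Z
  | Node A B => fun x => match x with
    | inl None => - k%:Z
    | inl (Some _) => k.+1%:Z
    | inr (inl y) => he_pot k.+1 y
    | inr (inr y) => he_pot k.+1 y
    end
  end.

Lemma he_pot_root (K : rtree m) k : he_pot k (he_root K) = - k%:Z.
Proof. by case: K. Qed.

Definition next (K : rtree m) (x y : he K) := [/\ y != x & y = he_turn x \/ y = he_turn (he_turn x)].

Lemma he_pot_next_root (K : rtree m) k (y : he K) : next (he_root K) y -> he_pot k y = k.+1%:Z.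
Proof. by case: K y => [i|A B] y [+ []] => /[swap] -> //=. Qed.

Lemma he_pot_next (K : rtree m) k (x y z : he K) :
  he_mate x = Some y -> next y z -> Num.lt (he_pot k x) (he_pot k z).
Proof.
elim: K k x y z => [//|A IA B IB] k [[[]|]|[x|x]] y z //= [<-] [].
- move=> zN zE; have [z' -> nz'] : exists2 z', z = inr (inr z') & next (he_root B) z'.
    by case: zE zN => -> /= N; eexists; try reflexivity; split; auto;
      apply: contra N => /eqP ->.
  by rewrite /= (he_pot_next_root _ nz'); lia.
- move=> zN zE; have [z' -> nz'] : exists2 z', z = inr (inl z') & next (he_root A) z'.
    by case: zE zN => -> /= N; eexists; try reflexivity; split; auto;
      apply: contra N => /eqP ->.
  by rewrite /= (he_pot_next_root _ nz'); lia.
- case E : (he_mate x) => [x'|] /= zN zE.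
    have [z' -> nz'] : exists2 z', z = inr (inl z') & next x' z'.
      by case: zE zN => -> /= N; eexists; try reflexivity; split; auto;
        apply: contra N => /eqP ->.
    by rewrite /=; apply: IA E nz'.
  rewrite (he_mate_None E) he_pot_root.
  by case: zE => -> /=; lia.
- case E : (he_mate x) => [x'|] /= zN zE.
    have [z' -> nz'] : exists2 z', z = inr (inr z') & next x' z'.
      by case: zE zN => -> /= N; eexists; try reflexivity; split; auto;
        apply: contra N => /eqP ->.
    by rewrite /=; apply: IB E nz'.
  rewrite (he_mate_None E) he_pot_root.
  by case: zE => -> /=; lia.
Qed.

Definition gpot (x : E) : int :=
  match x with inl y => he_pot 0 y | inr y => he_pot 0 y end.

Lemma gpot_step x z : z != gmate x ->
  z = gturn (gmate x) \/ z = gturn (gturn (gmate x)) -> Num.lt (gpot x) (gpot z).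
Proof.
have X K K' (y z' : he K) (w : he K') : next y z' -> he_mate w = None -> y = he_root K ->
    Num.lt (he_pot 0 w) (he_pot 0 z').
  by move=> + /he_mate_None -> yE; rewrite yE => /he_pot_next_root ->; rewrite he_pot_root.
case: x => x /=; case Ex: (he_mate x) => [y|] zN zE.
- have [z' -> nz'] : exists2 z', z = inl z' & next y z'.
    by case: zE zN => -> /= N; eexists; try reflexivity; split; auto;
        apply: contra N => /eqP ->.
  exact: he_pot_next Ex nz'.
- have [z' -> nz'] : exists2 z', z = inr z' & next (he_root J) z'.
    by case: zE zN => -> /= N; eexists; try reflexivity; split; auto;
        apply: contra N => /eqP ->.
  exact: X nz' Ex erefl.
- have [z' -> nz'] : exists2 z', z = inr z' & next y z'.
    by case: zE zN => -> /= N; eexists; try reflexivity; split; auto;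
        apply: contra N => /eqP ->.
  exact: he_pot_next Ex nz'.
- have [z' -> nz'] : exists2 z', z = inl z' & next (he_root I) z'.
    by case: zE zN => -> /= N; eexists; try reflexivity; split; auto;
        apply: contra N => /eqP ->.
  exact: X nz' Ex erefl.
Qed.

Lemma porbit_ghalf x y : (ghalf y \in porbit (turn glue) (ghalf x)) =
  (y \in [:: x; gturn x; gturn (gturn x)]).
Proof.
apply/idP/idP => [/porbitP[i]|].
  rewrite permX => yi.
  suff [z] : exists2 z, iter i (turn glue) (ghalf x) = ghalf z & z \in [:: x; gturn x; gturn (gturn x)].
    by rewrite -yi => /ghalf_inj ->.
  elim: i {yi} => [|i [z /= ->]]; first by exists x; rewrite ?inE ?eqxx.
  rewrite turn_ghalf !inE => zE; exists (gturn z) => //; rewrite !inE.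
  by case/or3P: zE => /eqP ->; rewrite ?gturnK3 eqxx ?orbT.
rewrite !inE => /or3P[] /eqP ->; first exact: porbit_id.
- by rewrite -turn_ghalf -[turn _ _]/((turn glue ^+ 1)%g _) mem_porbit.
- by rewrite -!turn_ghalf -permM -[(_ * _)%g]/((turn glue ^+ 2)%g) mem_porbit.
Qed.

(** Connected by induction on the positions, and acyclic by the potential. *)
Lemma glue_is_tree : is_tree glue.
Proof.
apply/and5P; split.
- by apply/card_gt0P; exists (inl (he_root I)).
- apply/forallP => h; have [x <-] := ghalfP h.
  by rewrite !mate_ghalf !(inj_eq ghalf_inj) gmate_neq gmateK eqxx.
- apply/forall_inP => A /imsetP[h _ ->]; have [x <-] := ghalfP h.
  have -> : #|porbit (turn glue) (ghalf x)| = #|[:: x; gturn x; gturn (gturn x)]|.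
    rewrite -(card_imset _ ghalf_inj); apply: eq_card => h'; have [y <-] := ghalfP h'.
    by rewrite porbit_ghalf mem_imset //; apply: ghalf_inj.
  have [E|N] := eqVneq (gturn x) x; first by rewrite !E (eq_card (B := pred1 x)) ?card1 // => y; rewrite !inE !orbb.
  have N2 : gturn (gturn x) != x.
    apply: contra N => /eqP e; rewrite -{1}e; apply/eqP; exact: gturnK3.
  rewrite (card_uniqP _) //= !inE negb_or (inj_eq (@gturn_inj _ _ _)) ![x == _]eq_sym.
  by rewrite N N2.
  rewrite /ribbon_connected; set r := (X in connect X).
  have r_mate (h : halfedge glue) : connect r h (mate h) by apply/connect1; rewrite /r eqxx.
  have r_turn (h : halfedge glue) : connect r h (turn glue h) by apply/connect1; rewrite /r eqxx orbT.
  pose h0 := ghalf (inl (he_root I)).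
  have to0 x : connect r (ghalf x) h0.
    move: x; apply: ghe_ind => [|x Hx|x Hx]; first exact: connect0.
      apply: connect_trans (r_turn _) _; rewrite turn_ghalf.
      by apply: connect_trans (r_turn _) _; rewrite turn_ghalf gturnK3.
    by apply: connect_trans (r_mate _) _; rewrite mate_ghalf gmateK.
  have from0 x : connect r h0 (ghalf x).
    move: x; apply: ghe_ind => [|x Hx|x Hx]; first exact: connect0.
      by rewrite -turn_ghalf; apply: connect_trans Hx _.
    by rewrite -mate_ghalf; apply: connect_trans Hx _.
  apply/forallP => h; apply/forallP => h'; have [[x <-] [y <-]] := (ghalfP h, ghalfP h').
  exact: connect_trans (to0 x) (from0 y).
- pose pot (h : halfedge glue) := gpot (enum_val h).
  have step h h' : walk_step h h' -> Num.lt (pot h) (pot h').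
    have [[x <-] [y <-]] := (ghalfP h, ghalfP h').
    rewrite /walk_step mate_ghalf porbit_ghalf (inj_eq ghalf_inj) /pot !enum_rankK.
    rewrite !inE => /andP[+ yN]; rewrite (negPf yN) /= => /orP yE.
    by apply: gpot_step => //; case: yE => /eqP; auto.
  have walk h h' : connect (@walk_step _ glue) h h' -> Num.le (pot h) (pot h').
    case/connectP=> p; elim: p h => [h _ ->|a p IH h /= /andP[/step ha ap] /(IH _ ap) ah]; first exact: Order.POrderTheory.lexx.
    exact: Order.POrderTheory.ltW (Order.POrderTheory.lt_le_trans ha ah).
  apply/forallP => h; apply/forallP => h'; apply/implyP => /step hh'.
  apply/negP => /walk h'h.
  by have := Order.POrderTheory.lt_le_trans hh' h'h; rewrite Order.POrderTheory.ltxx.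
Qed.

Lemma torder_glue : torder glue = (rorder I + rorder J)%N.
Proof. by apply: glued_torder glue_is_tree glue_glued. Qed.

End Canonical.

(** * The groups of trees in terms of pairs of rooted trees *)

Section TreeGroups.
Variable m : nat.

Lemma utree_glue n (I J : rtree m) : (rorder I + rorder J)%N = n ->
  exists t : utree m n, val t = glue I J.
Proof.
move=> IJ; have P : is_tree (glue I J) && (torder (glue I J) == n).
  by rewrite glue_is_tree torder_glue IJ eqxx.
by exists (Sub (glue I J) P); rewrite SubK.
Qed.

Lemma utree_tree n (t : utree m n) : is_tree (val t).
Proof. by case/andP: (valP t). Qed.
Hint Resolve utree_tree : core.

Lemma utree_glued n (t : utree m n) : exists I J, glued (val t) I J.
Proof.
have /and5P[t0 _ _ _ _] := utree_tree t.
pose d : halfedge (val t) := Ordinal t0.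
have [I dI] := subtree_exists d (utree_tree t).
have [J dJ] := subtree_exists (mate d) (utree_tree t).
by exists I, J, d.
Qed.

Lemma utree_order n (t : utree m n) I J :
  glued (val t) I J -> (rorder I + rorder J)%N = n.
Proof.
by move=> /(glued_torder (utree_tree t)) <-; case/andP: (valP t) => _ /eqP.
Qed.

(** The class of the tree [<I, J>], or 0 when its order is not [n]: with this
    default value the relations below need no assumption on the orders. *)
Definition gl n (I J : rtree m) : T m n :=
  if insub (glue I J) is Some t then Tcl t else 0.

Lemma gl_default n (I J : rtree m) : (rorder I + rorder J)%N <> n -> gl n I J = 0.
Proof.
by move/eqP/negPf => H; rewrite /gl insubF // torder_glue H andbF.
Qed.

Lemma Tcl_gl n (t : utree m n) I J : glued (val t) I J -> Tcl t = gl n I J.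
Proof.
move=> tIJ; have [s sE] := utree_glue (utree_order tIJ).
rewrite /gl -sE valK; apply/eqP; rewrite -subr_eq0 /Tcl -raddfB; apply/eqP.
apply/zpi_rel/T_iso/glued_iso => //; first exact: tIJ.
by rewrite sE; apply: glue_glued.
Qed.

Lemma gl_tree n (I J : rtree m) : (rorder I + rorder J)%N = n ->
  exists2 t : utree m n, gl n I J = Tcl t & glued (val t) I J.
Proof.
move=> /utree_glue[t tE]; have tIJ : glued (val t) I J by rewrite tE; apply: glue_glued.
by exists t; rewrite ?(Tcl_gl tIJ).
Qed.

Lemma gl_sym n (I J : rtree m) : gl n I J = gl n J I.
Proof.
have [/gl_tree[t -> tIJ]|N] := eqVneq (rorder I + rorder J)%N n.
  by apply/Tcl_gl/glued_sym.
by rewrite !gl_default //; move/eqP: N; lia.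
Qed.

Lemma gl_move n (A B C : rtree m) : gl n (Node A B) C = gl n A (Node B C).
Proof.
have [/gl_tree[t -> tIJ]|N] := eqVneq (rorder (Node A B) + rorder C)%N n.
  by apply/Tcl_gl/glued_move.
by rewrite !gl_default //; move/eqP: N => /=; lia.
Qed.

Lemma gl_AS n (A B C : rtree m) : gl n (Node A B) C + gl n (Node B A) C = 0.
Proof.
have [E|N] := eqVneq (rorder (Node A B) + rorder C)%N n; last first.
  by rewrite !gl_default ?addr0 //; move/eqP: N => /=; lia.
have [t -> tAB] := gl_tree E.
have E' : (rorder (Node B A) + rorder C)%N = n by rewrite -E /= [(_ B + _)%N]addnC.
have [t' -> tBA] := gl_tree E'.
rewrite /Tcl -raddfD; apply/zpi_rel/T_AS.
exact: glued_reversed tAB tBA.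
Qed.

Lemma gl_IHX n (A B C D : rtree m) : gl n (Node A (Node B C)) D -
  gl n (Node (Node A B) C) D + gl n (Node (Node A C) B) D = 0.
Proof.
have [E|N] := eqVneq (rorder (Node A (Node B C)) + rorder D)%N n; last first.
  by rewrite !gl_default ?subr0 ?addr0 //; move/eqP: N => /=; lia.
have [I -> tI] := gl_tree E.
have [|H -> tH] := @gl_tree n (Node (Node A B) C) D; first by move: E => /=; lia.
have [|X -> tX] := @gl_tree n (Node (Node A C) B) D; first by move: E => /=; lia.
rewrite /Tcl -raddfB -raddfD; apply/zpi_rel; exact: T_IHX tI tH tX.
Qed.

Section Relations.
Variables (G : zmodType) (b : rtree m -> rtree m -> G).
Hypotheses (b_sym : forall I J, b I J = b J I)
  (b_move : forall A B C, b (Node A B) C = b A (Node B C))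
  (b_AS : forall A B C, b (Node A B) C + b (Node B A) C = 0)
  (b_IHX : forall A B C D, b (Node A (Node B C)) D -
     b (Node (Node A B) C) D + b (Node (Node A C) B) D = 0).

(** Relations inside a tree are relations at the cut, once the cut is moved to
    where they take place. *)
Lemma invariant_compat K : lie_compat (b^~ K).
Proof.
have b_right A B C : b (Node A B) C = b B (Node C A) by rewrite [RHS]b_sym [RHS]b_move [RHS]b_sym.
split=> [J J' JJ'|I H X IHX].
- elim: JJ' K => {J J'} [A B|A A' B _ IH|A B B' _ IH] K //.
  + by rewrite !b_move.
  + by rewrite !b_right.
- elim: IHX K => {I H X} [A B C|I H X B _ IH|A I H X _ IH] K //.
  + by rewrite !b_move.
  + by rewrite !b_right.
Qed.

(** All the cuts of a connected tree are related by moving the cut across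
    vertices, so [b] has the same value at each of them. *)
Lemma invariant_cut (t : ribbon m) I J I' J' : is_tree t ->
  glued t I J -> glued t I' J' -> b I J = b I' J'.
Proof.
move=> t_tree [d dI dJ] [d' dI' dJ'].
case/and5P: (t_tree) => _ _ _ /forallP/(_ d)/forallP/(_ d')/connectP[p + d'E] _.
elim: p d I J dI dJ d'E => [|e p IH] d I J dI dJ /= d'E.
  by move: dI' dJ'; rewrite d'E => /(subtree_fun dI) -> /(subtree_fun dJ) ->.
case/andP => /orP[] /eqP eE ep.
  by rewrite b_sym; apply: (IH e) => //; rewrite eE ?mateK.
have [/eqP du|dN] := boolP (univalent d).
  by apply: (IH e) => //; rewrite eE du.
case: I dI => [i /subtree_LeafP[du]|A B dAB]; first by rewrite du in dN.
rewrite b_move b_sym; apply: (IH e) => //; rewrite eE.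
  exact: subtree_turn dAB dJ.
by have [] := subtree_NodeP dAB.
Qed.

(** The universal property of the group of trees, free of graphs: it is
    generated by pairs of rooted trees, subject to these relations. *)
Lemma Tlift n : exists phi : {additive T m n -> G},
  forall I J, (rorder I + rorder J)%N = n -> phi (gl n I J) = b I J.
Proof.
have cut (t : utree m n) : {IJ : rtree m * rtree m | glued (val t) IJ.1 IJ.2}.
  by apply: cid; have [I [J tIJ]] := utree_glued t; exists (I, J).
pose F (t : utree m n) := b (sval (cut t)).1 (sval (cut t)).2.
have FE t I J : glued (val t) I J -> F t = b I J.
  by move=> tIJ; apply: (invariant_cut (utree_tree t)) (svalP (cut t)) tIJ.
have F0 r : T_rel r -> flift F r = 0.
  case=> {r} [t t' tt'|t t' tt'|I H X A B C D gI gH gX].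
  - have [I [J tIJ]] := utree_glued t.
    by rewrite raddfB /= !fliftU (FE _ _ _ tIJ) (FE _ _ _ (iso_glued tt' tIJ)) subrr.
  - have [A [B [C [g g']]]] := reversed_glued (utree_tree t) (utree_tree t') tt'.
    by rewrite raddfD /= !fliftU (FE _ _ _ g) (FE _ _ _ g') b_AS.
  - by rewrite raddfD raddfB /= !fliftU (FE _ _ _ gI) (FE _ _ _ gH) (FE _ _ _ gX) b_IHX.
exists (zlift F0) => I J /gl_tree[t -> tIJ].
by rewrite /= /Tcl zliftE /= fliftU (FE _ _ _ tIJ).
Qed.

End Relations.

Lemma gl_compat n K : lie_compat ((gl n)^~ K).
Proof.
by apply: invariant_compat; [apply: gl_sym|apply: gl_move|apply: gl_AS|apply: gl_IHX].
Qed.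

Lemma gl_compat_r n K : lie_compat (gl n K).
Proof. by rewrite (_ : gl n K = (gl n)^~ K); [apply: gl_compat|apply/funext => J; apply: gl_sym]. Qed.

Definition form n : quasi_lie m -> quasi_lie m -> T m n :=
  blift (gl_compat n) (@gl_compat_r n).

Lemma form_tr n I J : form n (tr I) (tr J) = gl n I J.
Proof. exact: blift_trtr. Qed.

Lemma formBr n x y z : form n x (y - z) = form n x y - form n x z.
Proof. exact: raddfB. Qed.
Lemma formBl n x y z : form n (x - y) z = form n x z - form n y z.
Proof. exact: bliftBl. Qed.

Lemma form_sym n x y : form n x y = form n y x.
Proof.
move: x; apply: qlie_ind => [|x x' IH IH'|I].
- by rewrite -(subrr 0) formBl formBr !subrr.
- by rewrite formBl formBr IH IH'.
move: y; apply: qlie_ind => [|x x' IH IH'|J].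
- by rewrite -(subrr 0) formBl formBr !subrr.
- by rewrite formBl formBr IH IH'.
by rewrite !form_tr gl_sym.
Qed.

End TreeGroups.

(** * The bracket of the free quasi-Lie algebra *)

Section Bracket.
Variable m : nat.
Notation L := (quasi_lie m).

Lemma Node_compat_l (B : rtree m) : lie_compat (fun A => tr (Node A B)).
Proof.
split=> [J J' JJ'|I H X IHX]; first by apply/(tr_compat m).1/rneg_left.
by apply/(tr_compat m).2/rihx_left.
Qed.

Lemma Node_compat_r (A : rtree m) : lie_compat (fun B => tr (Node A B)).
Proof.
split=> [J J' JJ'|I H X IHX]; first by apply/(tr_compat m).1/rneg_right.
by apply/(tr_compat m).2/rihx_right.
Qed.

Definition qbr : L -> L -> L := blift Node_compat_l Node_compat_r.
HB.instance Definition _ x := GRing.Additive.on (qbr x).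

Definition qbr_r (y x : L) : L := qbr x y.
Lemma qbr_r_is_zmod_morphism y : zmod_morphism (qbr_r y).
Proof. exact: blift_r_is_zmod_morphism. Qed.
HB.instance Definition _ y := GRing.isZmodMorphism.Build L L (qbr_r y)
  (qbr_r_is_zmod_morphism y).

Lemma qbr_tr I J : qbr (tr I) (tr J) = tr (Node I J).
Proof. exact: blift_trtr. Qed.

Lemma qbrBr x y z : qbr x (y - z) = qbr x y - qbr x z.
Proof. exact: raddfB. Qed.
Lemma qbrBl x y z : qbr (x - y) z = qbr x z - qbr y z.
Proof. exact: (raddfB (qbr_r z)). Qed.
Lemma qbr0 x : qbr x 0 = 0. Proof. exact: raddf0. Qed.
Lemma qbr0l x : qbr 0 x = 0. Proof. exact: (raddf0 (qbr_r x)). Qed.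
Lemma qbrDr x y z : qbr x (y + z) = qbr x y + qbr x z.
Proof. exact: raddfD. Qed.
Lemma qbrDl x y z : qbr (x + y) z = qbr x z + qbr y z.
Proof. exact: (raddfD (qbr_r z)). Qed.
Lemma qbrNr x y : qbr x (- y) = - qbr x y.
Proof. exact: raddfN. Qed.

Lemma qbr_anti x y : qbr x y = - qbr y x.
Proof.
move: x; apply: qlie_ind => [|x x' IH IH'|I]; first by rewrite qbr0 qbr0l oppr0.
  by rewrite qbrBl qbrBr IH IH' opprD.
move: y; apply: qlie_ind => [|x x' IH IH'|J]; first by rewrite qbr0 qbr0l oppr0.
  by rewrite qbrBl qbrBr IH IH' opprD.
by apply/eqP; rewrite !qbr_tr -addr_eq0 (tr_compat m).1 //; constructor.
Qed.

Lemma qbr_jacobi x y z : qbr x (qbr y z) + qbr y (qbr z x) + qbr z (qbr x y) = 0.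
Proof.
pose jac x y z := qbr x (qbr y z) + qbr y (qbr z x) + qbr z (qbr x y).
have jacB x1 x2 y1 z1 : jac (x1 - x2) y1 z1 = jac x1 y1 z1 - jac x2 y1 z1.
  rewrite /jac !(qbrBl, qbrBr) !opprD.
  by rewrite [RHS]addrACA; congr (_ + _); rewrite [RHS]addrACA.
have jacC x1 y1 z1 : jac x1 y1 z1 = jac y1 z1 x1 by rewrite /jac -addrA addrC.
have jac0 y1 z1 : jac 0 y1 z1 = 0 by rewrite -[X in jac X](subrr 0) jacB subrr.
rewrite -/(jac x y z).
move: x; apply: qlie_ind => [//|x x' IH IH'|A]; first by rewrite jacB IH IH' subrr.
rewrite jacC.
move: y; apply: qlie_ind => [//|x x' IH IH'|B]; first by rewrite jacB IH IH' subrr.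
rewrite jacC.
move: z; apply: qlie_ind => [//|x x' IH IH'|C]; first by rewrite jacB IH IH' subrr.
rewrite jacC /jac -[RHS]((tr_compat m).2 _ _ _ (rihx_here A B C)) -!qbr_tr -!addrA.
congr (_ + _); rewrite addrC [qbr (tr C) _]qbr_anti; congr (_ + _).
by rewrite [RHS]qbr_anti [qbr (tr C) _]qbr_anti qbrNr.
Qed.

Lemma qbr_node x y z : qbr (qbr x y) z = qbr x (qbr y z) + qbr y (qbr z x).
Proof.
apply/eqP; rewrite [qbr (qbr x y) z]qbr_anti eq_sym -subr_eq0 opprK.
by rewrite qbr_jacobi.
Qed.

(** The cross terms cancel by antisymmetry: squares are additive, although
    [[x, x]] need not vanish. *)
Lemma qbr_sqD x y : qbr (x + y) (x + y) = qbr x x + qbr y y.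
Proof.
rewrite qbrDr !qbrDl [qbr y x]qbr_anti -addrA; congr (_ + _).
by rewrite addrA addNr add0r.
Qed.

Lemma qbr_sqB x y : qbr (x - y) (x - y) = qbr x x - qbr y y.
Proof. by rewrite qbr_sqD qbrNr [qbr (- y) y]qbr_anti qbrNr opprK. Qed.

Lemma qbr_sq_bracket x z : qbr (qbr x x) z = 0.
Proof. by rewrite qbr_node [qbr z x]qbr_anti qbrNr subrr. Qed.

Lemma qbr_sq2 x : qbr x x *+ 2 = 0.
Proof. by rewrite mulr2n {1}qbr_anti addNr. Qed.

End Bracket.

(** * The group [Z/2 (x) L'_(n+1)] *)

Section Tensor.
Variables m n : nat.
Notation L := (quasi_lie m).
Notation LT := (tensor 'Z_2 (Lprime m n.+1)).

Definition tens (a : 'Z_2) (x : Lprime m n.+1) : LT := zpi (@tensor_rel _ _) << (a, x) >>.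

Lemma tensDr a x y : tens a (x + y) = tens a x + tens a y.
Proof.
apply/eqP; rewrite -subr_eq0 opprD addrA /tens -!raddfB; apply/eqP/zpi_rel.
exact: tensorDr.
Qed.

Lemma tensDl a b x : tens (a + b) x = tens a x + tens b x.
Proof.
apply/eqP; rewrite -subr_eq0 opprD addrA /tens -!raddfB; apply/eqP/zpi_rel.
exact: tensorDl.
Qed.

Lemma tens0r a : tens a 0 = 0.
Proof. by apply: (@addrI _ (tens a 0)); rewrite -tensDr !addr0. Qed.
Lemma tens0l x : tens 0 x = 0.
Proof. by apply: (@addrI _ (tens 0 x)); rewrite -tensDl !addr0. Qed.

Lemma tens2 x : tens 1 x + tens 1 x = 0.
Proof. by rewrite -tensDl -[RHS](tens0l x); congr tens; apply/val_inj. Qed.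

(** The value off the degree [n + 1] part is arbitrary: [tens_tree] takes this
    map at trees of order [n] only. *)
Definition in_degree (x : L) : Lprime m n.+1 := odflt 0 (insub x).

Lemma rdegreeE (J : rtree m) : rdegree J = (rorder J).+1.
Proof. by elim: J => //= A -> B ->; rewrite addSn addnS. Qed.

Lemma in_degreeK (J : rtree m) : rorder J = n -> val (in_degree (tr J)) = tr J.
Proof.
move=> Jn; rewrite /in_degree insubT //; apply/asboolP/spanned_gen.
by apply: QLMonomial; rewrite rdegreeE Jn.
Qed.

Lemma rneg_order (J J' : rtree m) : rneg J J' -> rorder J' = rorder J.
Proof. by elim=> {J J'} /= [A B|A A' B _ ->|A B B' _ ->] //; rewrite addnC. Qed.

Lemma rihx_order (I H X : rtree m) : rihx I H X ->
  rorder H = rorder I /\ rorder X = rorder I.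
Proof.
elim=> {I H X} /= [A B C|I H X B _ [-> ->]|A I H X _ [-> ->]] //.
by split; lia.
Qed.

Definition tens_tree (J : rtree m) : LT :=
  if rorder J == n then tens 1 (in_degree (tr J)) else 0.

Lemma tens_tree_compat : lie_compat tens_tree.
Proof.
rewrite /tens_tree; split=> [J J' JJ'|I H X IHX].
  rewrite (rneg_order JJ'); case: eqP => Jn; rewrite ?addr0 // -tensDr.
  rewrite (_ : _ + _ = 0) ?tens0r //; apply: val_inj.
  by rewrite raddfD /= !in_degreeK ?(rneg_order JJ') //; apply: (tr_compat m).1.
have [-> ->] := rihx_order IHX; case: eqP => Jn; last by rewrite subr0 addr0.
have -> : tens 1 (in_degree (tr I)) - tens 1 (in_degree (tr H)) =
          tens 1 (in_degree (tr I) - in_degree (tr H)).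
  by apply/eqP; rewrite subr_eq -tensDr subrK.
rewrite -tensDr (_ : _ + _ = 0) ?tens0r //; apply: val_inj.
have [EH EX] := rihx_order IHX.
rewrite raddfD raddfB /= !in_degreeK ?EH ?EX //; exact: (tr_compat m).2.
Qed.

Definition tau : L -> LT := qlift tens_tree_compat.
HB.instance Definition _ := GRing.Additive.on tau.

Lemma tau_tr J : tau (tr J) = tens_tree J.
Proof. exact: qliftE. Qed.

Lemma tau_val (x : Lprime m n.+1) : tau (val x) = tens 1 x.
Proof.
have /asboolP := valP x; move E: (val x) => y ys.
elim: ys x E => {y} [y [J Jn]||y z ys IHy zs IHz] x xE.
- rewrite tau_tr /tens_tree -eqSS -rdegreeE Jn eqxx; congr tens; apply: val_inj.
  by rewrite xE in_degreeK //; apply/succn_inj; rewrite -rdegreeE.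
- by rewrite raddf0 (_ : x = 0) ?tens0r //; apply: val_inj.
- have [y' yE] : exists y' : Lprime m n.+1, val y' = y.
    by exists (Sub y (asboolT ys)); rewrite SubK.
  have [z' zE] : exists z' : Lprime m n.+1, val z' = z.
    by exists (Sub z (asboolT zs)); rewrite SubK.
  rewrite raddfB /= (IHy _ yE) (IHz _ zE); apply/eqP; rewrite subr_eq -tensDr.
  by apply/eqP; congr tens; apply: val_inj; rewrite raddfD /= xE yE zE subrK.
Qed.

Lemma tau_surj z : exists x, tau x = z.
Proof.
have [y <-] := zpi_surj z; move: y.
apply: freeg_ind => [|x y [x' xE] [y' yE]|[a x]]; first by exists 0; rewrite !raddf0.
  by exists (x' - y'); rewrite !raddfB /= xE yE.
rewrite -[zpi _ _]/(tens a x); case: a => [[|[|//]] a].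
  by exists 0; rewrite raddf0 -[LHS](tens0l x); congr tens; apply: val_inj.
by exists (val x); rewrite tau_val; congr tens; apply: val_inj.
Qed.

Lemma tau2 x : tau x *+ 2 = 0.
Proof.
rewrite -raddfMn; move: x; apply: qlie_ind => [|x y Hx Hy|J].
- by rewrite mul0rn raddf0.
- by rewrite mulrnBl raddfB /= Hx Hy subr0.
- by rewrite raddfMn /= tau_tr /tens_tree; case: eqP => _; rewrite ?mul0rn // mulr2n tens2.
Qed.

Section TensorLift.
Variables (G : zmodType) (phi : {additive L -> G}).
Hypothesis phi2 : forall x, phi x *+ 2 = 0.

(** Defining [theta] on [(a, x)] as [a] times [phi x] makes the residue class
    [a] act through a representative, which is harmless as [2 phi = 0]. *)
Lemma tensor_lift : exists theta : {additive LT -> G},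
  forall J, rorder J = n -> theta (tau (tr J)) = phi (tr J).
Proof.
pose F (ax : 'Z_2 * Lprime m n.+1) := phi (val ax.2) *+ (ax.1 : nat).
have F0 r : tensor_rel r -> flift F r = 0.
  case=> {r} [a a' x|a x x']; rewrite !raddfB /= !fliftU /F /=; last first.
    by rewrite raddfD mulrnDl addrAC addrK subrr.
  case: a a' => [[|[|//]] ?] [[|[|//]] ?] /=; rewrite /= ?mulr0n ?mulr1n ?subr0 ?subrr //.
  by rewrite sub0r -opprD -mulr2n phi2 oppr0.
exists (zlift F0) => J Jn; rewrite tau_tr /tens_tree Jn eqxx /tens /= zliftE /= fliftU.
by rewrite /F /= in_degreeK.
Qed.

End TensorLift.
End Tensor.

(** * The first exact sequence *)

Section Twisted.
Variables m n : nat.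
Notation L := (quasi_lie m).
Notation TT := (T m (2 * n)).
Notation f := (@form m (2 * n)).

Lemma formDr x y z : f x (y + z) = f x y + f x z.
Proof. exact: raddfD. Qed.
Lemma formDl x y z : f (x + y) z = f x z + f y z.
Proof. exact: (raddfD (blift_r (gl_compat (2 * n)) (@gl_compat_r m (2 * n)) z)). Qed.
Lemma form0r x : f x 0 = 0. Proof. exact: raddf0. Qed.
Lemma form0l x : f 0 x = 0. Proof. by rewrite form_sym form0r. Qed.
Lemma formNr x y : f x (- y) = - f x y. Proof. exact: raddfN. Qed.
Lemma formNl x y : f (- x) y = - f x y.
Proof. by rewrite form_sym formNr form_sym. Qed.

(** The central extension of the free quasi-Lie algebra with cocycle [- f].
    There [(0, x)] is quadratic in [x], with polarization [f], as are the symbols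
    [J^oo]; but the relation [2 J^oo = <J, J>] fails in it. *)
Definition twisted := (TT * L)%type.
HB.instance Definition _ := Choice.on twisted.

Definition tw_add (p q : twisted) : twisted := (p.1 + q.1 - f p.2 q.2, p.2 + q.2).
Definition tw_opp (p : twisted) : twisted := (- p.1 - f p.2 p.2, - p.2).
Definition tw_zero : twisted := (0, 0).

Lemma tw_addA : associative tw_add.
Proof.
move=> [p1 p2] [q1 q2] [r1 r2]; rewrite /tw_add /=; congr (_, _); last exact: addrA.
rewrite formDl formDr; abel.
Qed.

Lemma tw_addC : commutative tw_add.
Proof.
by move=> [p1 p2] [q1 q2]; rewrite /tw_add /= form_sym; congr (_, _); abel.
Qed.

Lemma tw_add0 : left_id tw_zero tw_add.
Proof. by move=> [p1 p2]; rewrite /tw_add /= form0l !add0r subr0. Qed.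

Lemma tw_addN : left_inverse tw_zero tw_opp tw_add.
Proof.
move=> [p1 p2]; rewrite /tw_add /= formNl; congr (_, _); abel.
Qed.

HB.instance Definition _ := GRing.isZmodule.Build twisted tw_addA tw_addC tw_add0 tw_addN.

Lemma tw_addE (p q : twisted) : p + q = (p.1 + q.1 - f p.2 q.2, p.2 + q.2).
Proof. by []. Qed.

Definition tw_quad (x : L) : twisted := (0, x).
Definition tw_central (a : TT) : twisted := (a, 0).

Lemma tw_central_is_zmod_morphism : zmod_morphism tw_central.
Proof.
move=> a b; apply/eqP; rewrite eq_sym subr_eq; apply/eqP.
by rewrite /tw_central tw_addE /= form0l subrK subr0 addr0.
Qed.
HB.instance Definition _ := GRing.isZmodMorphism.Build _ _ tw_central tw_central_is_zmod_morphism.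

(** This is [2 (0, x) - (f x x, 0)], the failure of [2 x^oo = <x, x>].  It is
    additive in [x], although both of its terms are quadratic. *)
Definition tw_double (x : L) : twisted := (- f x x - f x x, x + x).

Lemma tw_double_is_zmod_morphism : zmod_morphism tw_double.
Proof.
move=> x y; apply/eqP; rewrite eq_sym subr_eq; apply/eqP.
rewrite /tw_double tw_addE /=; congr (_, _); last abel.
rewrite !(formDl, formDr, formNl, formNr) (form_sym _ y x); abel.
Qed.
HB.instance Definition _ := GRing.isZmodMorphism.Build _ _ tw_double tw_double_is_zmod_morphism.

(** If [2 x = 0] then [2 (f x x) = f (2 x) x = 0]: the relations meet the centre
    trivially.  This is why trees inject into the twisted group. *)
Lemma tw_double_central x a : tw_double x = tw_central a -> a = 0.
Proof.
by case=> <- x2; rewrite -opprD -formDl x2 form0l oppr0.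
Qed.

Definition tw_fun (p : TT * {freeg (rtree_of m n)}) : twisted :=
  tw_central p.1 + flift (fun J => tw_quad (tr (val J))) p.2.

Lemma tw_fun_is_zmod_morphism : zmod_morphism tw_fun.
Proof. by move=> [a D] [b E]; rewrite /tw_fun !raddfB /=; abel. Qed.
HB.instance Definition _ := GRing.isZmodMorphism.Build _ _ tw_fun tw_fun_is_zmod_morphism.

Lemma tw_quadB x y :
  tw_central (f x y) + tw_quad (x - y) = tw_double (- y) + (tw_quad x + tw_quad y).
Proof.
rewrite /tw_central /tw_quad /tw_double !tw_addE /= form0l; congr (_, _); last abel.
rewrite !(formDl, formDr, formNl, formNr) (form_sym _ y x); abel.
Qed.

(** All the relations of the twisted group, not only [2 J^oo = <J, J>], become
    values of [tw_double]. *)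
Lemma tw_rel p : Tinf_even_rel p -> exists x, tw_fun p = tw_double x.
Proof.
case=> {p} [J J' JJ'|J t tJ|I H X t IHX tHX]; rewrite /tw_fun /=.
- exists (tr (val J)); rewrite raddf0 add0r raddfB /= !fliftU.
  apply/eqP; rewrite subr_eq; apply/eqP.
  have /eqP := (tr_compat m).1 _ _ JJ'; rewrite addrC addr_eq0 => /eqP ->.
  rewrite /tw_quad tw_addE /=; congr (_, _); last abel.
  rewrite !(formDl, formNr); abel.
- exists (tr (val J)); rewrite mulr2n raddfD /= !fliftU (Tcl_gl tJ) -form_tr.
  rewrite /tw_central /tw_quad /tw_double !tw_addE /= form0l add0r; congr (_, _); abel.
- have -> : Tcl t = f (tr (sval H)) (tr (sval X)) by rewrite (Tcl_gl tHX) -form_tr.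
  exists (- tr (val X)).
  have -> : << I >> - << H >> - << X >> = << I >> - (<< H >> + << X >>) :> {freeg (rtree_of m n)} by abel.
  rewrite raddfB raddfD /= !fliftU addrA; apply/eqP; rewrite subr_eq; apply/eqP.
  have -> : tr (val I) = tr (val H) - tr (val X).
    by apply/eqP; rewrite -subr_eq0 opprB addrA addrAC; apply/eqP/(tr_compat m).2.
  exact: tw_quadB.
Qed.

Lemma T_to_Tinf_inj : injective (T_to_Tinf m n).
Proof.
apply: raddf_inj => a /zpi_eq0 a0.
suff [x] : exists x, tw_fun (a, 0) = tw_double x.
  rewrite /tw_fun /= raddf0 addr0 => /esym; exact: tw_double_central.
elim: a0 => [p /tw_rel //||p q _ [x px] _ [y qy]]; first by exists 0; rewrite !raddf0.
by exists (x - y); rewrite !raddfB /= px qy.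
Qed.

End Twisted.

Section FirstSequence.
Variables m n : nat.
Notation L := (quasi_lie m).
Notation TI := (Tinf_even m n).
Notation LT := (tensor 'Z_2 (Lprime m n.+1)).

Definition infty (J : rtree_of m n) : TI := zpi (@Tinf_even_rel m n) (0, << J >>).

Definition Tinf_to_tensor_fun (p : T m (2 * n) * {freeg (rtree_of m n)}) : LT :=
  flift (fun J => tau n (tr (val J))) p.2.
Lemma Tinf_to_tensor_fun_is_zmod_morphism : zmod_morphism Tinf_to_tensor_fun.
Proof. by move=> [a D] [b E]; rewrite /Tinf_to_tensor_fun raddfB. Qed.
HB.instance Definition _ := GRing.isZmodMorphism.Build _ _ Tinf_to_tensor_fun
  Tinf_to_tensor_fun_is_zmod_morphism.

Lemma Tinf_to_tensor_rel p : Tinf_even_rel p -> Tinf_to_tensor_fun p = 0.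
Proof.
case=> {p} [J J' JJ'|J t tJ|I H X t IHX tHX]; rewrite /Tinf_to_tensor_fun /=.
- rewrite raddfB /= !fliftU.
  have /eqP := (tr_compat m).1 _ _ JJ'; rewrite addr_eq0 => /eqP ->.
  by rewrite raddfN /= -opprD -mulr2n tau2 oppr0.
- by rewrite raddfMn /= fliftU tau2.
- have -> (F : rtree_of m n -> LT) : flift F (<< I >> - << H >> - << X >>) = F I - F H - F X.
    by rewrite !raddfB /= !fliftU.
  rewrite -2!(raddfB (tau n)).
  rewrite -[RHS](tau2 n (- tr (val X))) -raddfMn; congr (tau n _).
  have /= IHX0 := (tr_compat m).2 _ _ _ IHX.
  by apply/eqP; rewrite -subr_eq0 -[X in _ == X]IHX0; apply/eqP => /=; abel.
Qed.

Definition Tinf_to_tensor : {additive TI -> LT} := zlift Tinf_to_tensor_rel.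

Lemma Tinf_to_tensorE a D : Tinf_to_tensor (zpi (@Tinf_even_rel m n) (a, D)) =
  flift (fun J => tau n (tr (val J))) D.
Proof. exact: (zliftE Tinf_to_tensor_rel). Qed.

(** The symbols [J^oo] satisfy the relations of [Z/2 (x) L'] modulo trees, so
    they give an inverse of the map above modulo trees. *)
Lemma Tinf_to_tensor_ker y : Tinf_to_tensor y = 0 -> exists x, T_to_Tinf m n x = y.
Proof.
pose S y := exists x, T_to_Tinf m n x = y.
pose kap a D : zquot S := zpi S (zpi (@Tinf_even_rel m n) (a, D)).
have kapB a b D E : kap (a - b) (D - E) = kap a D - kap b E by rewrite /kap -!raddfB.
have kap0 a : kap a 0 = 0 by apply: zpi_rel; exists a.
have k0B D E : kap 0 (D - E) = kap 0 D - kap 0 E by rewrite -kapB subr0.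
have k0N D : kap 0 (- D) = - kap 0 D by rewrite -[- D]sub0r k0B kap0 sub0r.
have k0D D E : kap 0 (D + E) = kap 0 D + kap 0 E by rewrite -{1}(opprK E) k0B k0N opprK.
have kap_rel a D : Tinf_even_rel (a, D) -> kap 0 D = 0.
  move=> /zpi_rel aD; have := kapB a a D 0; rewrite subrr subr0 kap0 subr0 => ->.
  by rewrite /kap aD raddf0.
pose c J := kap 0 << J >>.
have c2 J : c J + c J = 0.
  have [|t _ tJ] := @gl_tree m (2 * n) (val J) (val J).
    by rewrite (eqP (valP J)) mul2n addnn.
  have := kap_rel _ _ (inf_double tJ); by rewrite mulr2n k0D.
have cN J : - c J = c J by apply/esym/eqP; rewrite -addr_eq0 c2.
have cneg J J' : rneg (val J) (val J') -> c J + c J' = 0.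
  move=> JJ'; have := kap_rel _ _ (inf_neg JJ'); by rewrite k0B -/(c J) -/(c J') cN.
have cIHX I H X : rihx (val I) (val H) (val X) -> c I - c H + c X = 0.
  move=> IHX; have [EH EX] := rihx_order IHX.
  have [|t _ tHX] := @gl_tree m (2 * n) (val H) (val X).
    by rewrite EH EX (eqP (valP I)) mul2n addnn.
  have := kap_rel _ _ (inf_IHX IHX tHX).
  by rewrite !k0B -/(c I) -/(c H) -/(c X) (cN X).
pose q (J : rtree m) := if insub J is Some J' then c J' else 0.
have q_in J (Jn : rorder J == n) : q J = c (Sub J Jn) by rewrite /q insubT.
have q_out J : (rorder J == n) = false -> q J = 0 by move=> Jn; rewrite /q insubF.
have q_compat : lie_compat q.
  split=> [J J' JJ'|I H X IHX].
    have E := rneg_order JJ'; case Jn : (rorder J == n); last first.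
      by rewrite !q_out ?E // addr0.
    have J'n := Jn; rewrite -E in J'n.
    by rewrite (q_in _ Jn) (q_in _ J'n); apply: cneg.
  have [EH EX] := rihx_order IHX; case In : (rorder I == n); last first.
    by rewrite !q_out ?EH ?EX // subr0 addr0.
  have Hn := In; rewrite -EH in Hn; have Xn := In; rewrite -EX in Xn.
  by rewrite (q_in _ In) (q_in _ Hn) (q_in _ Xn); apply: cIHX.
have [phi phiE] : exists phi : {additive L -> zquot S}, forall J, phi (tr J) = q J.
  by exists (qlift q_compat) => J; apply: qliftE.
have q2 x : phi x *+ 2 = 0.
  move: x; apply: qlie_ind => [|x x' Hx Hx'|J]; first by rewrite raddf0 mul0rn.
    by rewrite (raddfB phi) mulrnBl Hx Hx' subr0.
  by rewrite phiE /q mulr2n; case: insub => [J'|]; rewrite ?addr0.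
have [theta thetaE] := @tensor_lift m n _ phi q2.
have inv : theta (Tinf_to_tensor y) = zpi S y.
  have [[a D] <-] := zpi_surj y; rewrite Tinf_to_tensorE -[RHS]/(kap a D).
  have -> : kap a D = kap 0 D by have := kapB a a D 0; rewrite subrr subr0 kap0 subr0.
  move: D; apply: freeg_ind => [|D E IH IH'|J]; first by rewrite (raddf0 (flift _)) (raddf0 theta) kap0.
    by rewrite (raddfB (flift _)) (raddfB theta) IH IH' -kapB subr0.
  by rewrite fliftU thetaE ?(eqP (valP J)) // phiE q_in ?(valP J) // => Jn; congr c; apply: val_inj.
move=> y0; have : zpi S y = 0 by rewrite -inv y0 raddf0.
move/zpi_eq0; elim=> [//||p r _ [u <-] _ [v <-]]; first by exists 0; rewrite raddf0.
by exists (u - v); rewrite raddfB.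
Qed.

Lemma first_sequence : exists g : {additive TI -> LT}, short_exact (T_to_Tinf m n) g.
Proof.
exists Tinf_to_tensor; split=> [|y|z]; first exact: T_to_Tinf_inj.
- split; first exact: Tinf_to_tensor_ker.
  by case=> x <-; rewrite -[T_to_Tinf _ _ _]/(zpi _ (x, 0)) Tinf_to_tensorE (raddf0 (flift _)).
- have [x <-] := tau_surj z; move: x.
  apply: qlie_ind => [|x x' [y yE] [y' yE']|J].
  + by exists 0; rewrite !raddf0.
  + by exists (y - y'); rewrite !raddfB /= yE yE'.
  case Jn : (rorder J == n); last first.
    by exists 0; rewrite raddf0 tau_tr /tens_tree Jn.
  exists (infty (Sub J Jn)).
  by rewrite /infty Tinf_to_tensorE fliftU SubK.
Qed.
End FirstSequence.

(** * Coefficients in the free associative algebra over [F2] *)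

Section Words.
Variable m : nat.
Notation word := (seq 'I_m).
Notation W := (word -> bool).
Notation W2 := (word * word -> bool).

Definition wadd (T : Type) (f g : T -> bool) : T -> bool := fun w => f w + g w.

Lemma waddE T (f g : T -> bool) w : wadd f g w = f w + g w.
Proof. by []. Qed.

(** Left multiplication by the image of a tree in the algebra of formal series
    in noncommuting variables; a series is given by its coefficients. *)
Fixpoint op (J : rtree m) : W -> W :=
  match J with
  | Leaf i => fun f w => if w is j :: v then (i == j) && f v else false
  | Node A B => fun f => wadd (op A (op B f)) (op B (op A f))
  end.

Lemma opD J f g : op J (wadd f g) = wadd (op J f) (op J g).
Proof.
elim: J f g => [i|A IA B IB] f g; apply/funext => w.
  by case: w => [|j v] //=; rewrite /wadd; case: (i == j).
by rewrite /= !(IA, IB) !waddE; abel2.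
Qed.

Lemma op0 J : op J (fun _ => false) = fun _ => false.
Proof.
elim: J => [i|A IA B IB]; apply/funext => w.
  by case: w => [|j v] //=; rewrite andbF.
by rewrite /= !(IA, IB) /wadd.
Qed.

Lemma op_scale J c f : op J (fun w => c && f w) = fun w => c && op J f w.
Proof. by case: c => //=; rewrite op0. Qed.

Definition op1 J (F : W2) : W2 := fun p => op J (fun s => F (s, p.2)) p.1.
Definition op2 J (F : W2) : W2 := fun p => op J (fun s => F (p.1, s)) p.2.

Lemma op1D J F G : op1 J (wadd F G) = wadd (op1 J F) (op1 J G).
Proof. by apply/funext => p; rewrite /op1 -[LHS]/(op J (wadd _ _) _) opD. Qed.

Lemma op2D J F G : op2 J (wadd F G) = wadd (op2 J F) (op2 J G).
Proof. by apply/funext => p; rewrite /op2 -[LHS]/(op J (wadd _ _) _) opD. Qed.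

Lemma op1_Node A B F : op1 (Node A B) F = wadd (op1 A (op1 B F)) (op1 B (op1 A F)).
Proof. by []. Qed.

Lemma op2_Node A B F : op2 (Node A B) F = wadd (op2 A (op2 B F)) (op2 B (op2 A F)).
Proof. by []. Qed.

Lemma op21 A B F : op2 A (op1 B F) = op1 B (op2 A F).
Proof.
apply/funext => -[u v]; rewrite /op1 /op2 /=; elim: B u F => [i|B IB C IC] u F /=.
  by case: u => [|j u]; rewrite ?op0 // op_scale.
rewrite -[fun s => wadd _ _ _]/(wadd (fun s => op B (op C (fun s0 => F (s0, s))) u)
   (fun s => op C (op B (fun s0 => F (s0, s))) u)) opD !waddE.
rewrite (IB u (fun p => op C (fun s => F (s, p.2)) p.1)).
rewrite (IC u (fun p => op B (fun s => F (s, p.2)) p.1)) /=.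
have -> : (fun s => op A (fun s0 => op C (fun s1 => F (s1, s0)) s) v) =
    op C (fun s => op A (fun s0 => F (s, s0)) v) by apply/funext => s; apply: IC.
have -> : (fun s => op A (fun s0 => op B (fun s1 => F (s1, s0)) s) v) =
    op B (fun s => op A (fun s0 => F (s, s0)) v) by apply/funext => s; apply: IB.
by [].
Qed.

Definition wsym (F : W2) := forall u v, F (u, v) = F (v, u).

(** On the diagonal of a symmetric [F], exchanging the two arguments exchanges
    the two operators: these terms of the Jacobi identity cancel in pairs. *)
Lemma diag_swap A B F u : wsym F -> op1 A (op2 B F) (u, u) = op1 B (op2 A F) (u, u).
Proof.
move=> Fs; rewrite -op21 /op1 /op2 /=; congr (op B _ _); apply/funext => s.
by congr (op A _ _); apply/funext => s'; apply: Fs.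
Qed.

(** The coefficients of a tree in the free associative algebra. *)
Definition coef J : W := op J (fun w => w == [::]).

Lemma coef_Node A B : coef (Node A B) = wadd (op A (coef B)) (op B (coef A)).
Proof. by []. Qed.

Definition mix (f g : W) : W2 := fun p => f p.1 && g p.2.

Lemma mixC f g u : mix f g (u, u) = mix g f (u, u).
Proof. exact: andbC. Qed.
Lemma mixDl f g h : mix (wadd f g) h = wadd (mix f h) (mix g h).
Proof. by apply/funext => p; rewrite /mix /wadd; case: (f _); case: (g _); case: (h _). Qed.
Lemma mixDr f g h : mix h (wadd f g) = wadd (mix h f) (mix h g).
Proof. by apply/funext => p; rewrite /mix /wadd; case: (f _); case: (g _); case: (h _). Qed.
Lemma op1_mix J f g : op1 J (mix f g) = mix (op J f) g.
Proof.
apply/funext => p; rewrite /op1 /mix /=.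
rewrite (_ : (fun s => _) = fun s => g p.2 && f s) ?op_scale 1?andbC //.
by apply/funext => s; rewrite andbC.
Qed.
Lemma op2_mix J f g : op2 J (mix f g) = mix f (op J g).
Proof. by apply/funext => p; rewrite /op2 /mix /= op_scale. Qed.

(** The free Lie algebra acts on the left regular module [T], hence on the
    symmetric square of [T] over [F2].  The semidirect product of the three is
    a quasi-Lie algebra, in which [[x, x]] is [x . x] for [x] in [T].
    [offdiag] and [diag] are the coefficients of the last component at [u . v]
    with [u <> v], and at [u . u]. *)
Fixpoint offdiag (J : rtree m) : W2 :=
  match J with
  | Leaf _ => fun _ => false
  | Node A B => wadd (wadd (wadd (op1 A (offdiag B)) (op2 A (offdiag B)))
                           (wadd (op1 B (offdiag A)) (op2 B (offdiag A))))
                     (wadd (mix (coef A) (coef B)) (mix (coef B) (coef A)))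
  end.

Definition diag (J : rtree m) : W :=
  match J with
  | Leaf _ => fun _ => false
  | Node A B => fun u => op1 A (offdiag B) (u, u) + op1 B (offdiag A) (u, u)
                         + mix (coef A) (coef B) (u, u)
  end.

Lemma offdiag_sym J : wsym (offdiag J).
Proof.
elim: J => [//|A IA B IB] u v /=; rewrite !waddE /op1 /op2 /mix /=.
have E C D : wsym (offdiag D) -> forall x y,
   op C (fun s => offdiag D (x, s)) y = op C (fun s => offdiag D (s, x)) y.
  by move=> Ds x y; congr (op C _ _); apply/funext => s; apply: Ds.
rewrite !(E _ _ IA) !(E _ _ IB) ![coef B _ && _]andbC; abel2.
Qed.

Lemma op_rneg J J' : rneg J J' -> op J = op J'.
Proof.
elim=> {J J'} [A B|A A' B _ IH|A B B' _ IH]; apply/funext => f; apply/funext => w /=;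
  rewrite ?IH // !waddE; abel2.
Qed.

Lemma coef_rneg J J' : rneg J J' -> coef J = coef J'.
Proof. by move=> /op_rneg JJ'; rewrite /coef JJ'. Qed.

Lemma offdiag_rneg J J' : rneg J J' -> offdiag J = offdiag J'.
Proof.
elim=> {J J'} [A B|A A' B AA' IH|A B B' BB' IH]; apply/funext => p /=.
- rewrite !waddE; abel2.
- by rewrite IH (coef_rneg AA') /op1 /op2 (op_rneg AA').
- by rewrite IH (coef_rneg BB') /op1 /op2 (op_rneg BB').
Qed.

Lemma diag_rneg J J' : rneg J J' -> diag J = diag J'.
Proof.
case=> {J J'} [A B|A A' B AA'|A B B' BB']; apply/funext => u /=.
- rewrite [mix (coef B) _ _]mixC; abel2.
- by rewrite (offdiag_rneg AA') (coef_rneg AA') /op1 (op_rneg AA').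
- by rewrite (offdiag_rneg BB') (coef_rneg BB') /op1 (op_rneg BB').
Qed.

Lemma op_rihx I H X : rihx I H X -> forall f, op I f = wadd (op H f) (op X f).
Proof.
elim=> {I H X} [A B C|I H X B _ IH|A I H X _ IH] f; apply/funext => w /=.
- rewrite !opD !waddE; abel2.
- by rewrite !IH opD !waddE; abel2.
- by rewrite !IH opD !waddE; abel2.
Qed.

Lemma coef_rihx I H X : rihx I H X -> coef I = wadd (coef H) (coef X).
Proof. by move=> IHX; rewrite /coef (op_rihx IHX). Qed.

Lemma op1_rihx I H X : rihx I H X -> forall F, op1 I F = wadd (op1 H F) (op1 X F).
Proof. by move=> IHX F; apply/funext => p; rewrite /op1 (op_rihx IHX). Qed.

Lemma op2_rihx I H X : rihx I H X -> forall F, op2 I F = wadd (op2 H F) (op2 X F).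
Proof. by move=> IHX F; apply/funext => p; rewrite /op2 (op_rihx IHX). Qed.

Lemma offdiag_rihx I H X : rihx I H X -> offdiag I = wadd (offdiag H) (offdiag X).
Proof.
elim=> {I H X} [A B C|I H X B IHX IH|A I H X IHX IH]; apply/funext => p /=.
- rewrite !(coef_Node, mixDl, mixDr, op1D, op2D, op1_Node, op2_Node, op1_mix, op2_mix, op21) !waddE.
  abel2.
- rewrite IH (coef_rihx IHX) !(op1_rihx IHX, op2_rihx IHX, op1D, op2D, mixDl, mixDr) !waddE.
  abel2.
- rewrite IH (coef_rihx IHX) !(op1_rihx IHX, op2_rihx IHX, op1D, op2D, mixDl, mixDr) !waddE.
  abel2.
Qed.

Lemma diag_rihx I H X : rihx I H X -> diag I = wadd (diag H) (diag X).
Proof.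
case=> {I H X} [A B C|I H X B IHX|A I H X IHX]; apply/funext => u; rewrite waddE /=.
- rewrite !(coef_Node, mixDl, mixDr, op1D, op1_Node, op1_mix) !waddE.
  rewrite (diag_swap A B _ (offdiag_sym C)) (diag_swap A C _ (offdiag_sym B)).
  rewrite (diag_swap B C _ (offdiag_sym A)).
  rewrite (mixC (op A (coef C))) (mixC (op C (coef A)) (coef B)).
  rewrite (mixC (coef A) (op B (coef C))) (mixC (coef A) (op C (coef B))).
  rewrite (mixC (op A (coef B))).
  abel2.
- rewrite (offdiag_rihx IHX) (coef_rihx IHX) !(op1_rihx IHX, op1D, mixDl, mixDr) !waddE.
  abel2.
- rewrite (offdiag_rihx IHX) (coef_rihx IHX) !(op1_rihx IHX, op1D, mixDl, mixDr) !waddE.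
  abel2.
Qed.

Lemma bool_compat (f : rtree m -> bool) : (forall J J', rneg J J' -> f J = f J') ->
  (forall I H X, rihx I H X -> f I = f H + f X) -> lie_compat f.
Proof.
move=> fn fi; split=> [J J' /fn ->|I H X /fi ->]; first exact: bool_addxx.
abel2.
Qed.

Lemma coef_compat w : lie_compat (fun J => coef J w).
Proof. by apply: bool_compat => [J J' /coef_rneg ->|I H X /coef_rihx ->]. Qed.

Lemma diag_compat w : lie_compat (fun J => diag J w).
Proof. by apply: bool_compat => [J J' /diag_rneg ->|I H X /diag_rihx ->]. Qed.

Definition qcoef w : {additive quasi_lie m -> bool} := qlift (coef_compat w).
Definition qdiag w : {additive quasi_lie m -> bool} := qlift (diag_compat w).

Lemma qcoef_tr w J : qcoef w (tr J) = coef J w.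
Proof. exact: qliftE. Qed.

Lemma qdiag_tr w J : qdiag w (tr J) = diag J w.
Proof. exact: qliftE. Qed.

(** The point of the construction: squares do not vanish in the quasi-Lie
    algebra, and they retain the associative coefficients of their root. *)
Lemma qdiag_square w J : qdiag w (tr (Node J J)) = coef J w.
Proof. by rewrite qdiag_tr /= /mix /= bool_addxx add0r andbb. Qed.

End Words.

(** * Lyndon trees *)

Section Lyndon.
Variable m : nat.
Notation word := (seq 'I_m).
Notation L := (quasi_lie m).

(** The strict lexicographic order, in which a proper prefix is smaller. *)
Fixpoint wlt (s t : word) : bool :=
  match s, t with
  | _, [::] => false
  | [::], _ :: _ => true
  | x :: s', y :: t' => (x < y)%N || (x == y) && wlt s' t'
  end.

Lemma wltxx s : wlt s s = false.
Proof. by elim: s => //= x s ->; rewrite ltnn eqxx. Qed.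

Lemma wlt_trans t s u : wlt s t -> wlt t u -> wlt s u.
Proof.
elim: s t u => [|x s IH] [|y t] [|z u] //=.
case/orP=> [xy|/andP[/eqP <- st]]; case/orP=> [yz|/andP[/eqP <- tu]].
- by rewrite (ltn_trans xy yz).
- by rewrite xy.
- by rewrite yz.
- by rewrite eqxx (IH _ _ st tu) orbT.
Qed.

Lemma wlt_asym s t : wlt s t -> ~~ wlt t s.
Proof. by move=> st; apply/negP => /(wlt_trans st); rewrite wltxx. Qed.

Lemma wlt_total s t : [\/ wlt s t, s = t | wlt t s].
Proof.
elim: s t => [|x s IH] [|y t] /=; [exact: Or32|exact: Or31|exact: Or33|].
have [->|xy] := eqVneq x y.
  rewrite ltnn /= ?eqxx /=; case: (IH t) => [|->|]; [exact: Or31|exact: Or32|exact: Or33].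
rewrite ?orbF; case: (ltngtP x y) => [_|_|/val_inj/eqP]; [exact: Or31|exact: Or33|].
by rewrite (negPf xy).
Qed.

Lemma wle_lt_trans t s u : ~~ wlt t s -> wlt t u -> wlt s u.
Proof. by case: (wlt_total s t) => [st _ /(wlt_trans st)|-> //|->]. Qed.

Lemma wlt_le_trans t s u : wlt s t -> ~~ wlt u t -> wlt s u.
Proof. by case: (wlt_total t u) => [tu /wlt_trans/(_ tu)|<- //|->]. Qed.

Lemma wlt_cat2l s t u : wlt (s ++ t) (s ++ u) = wlt t u.
Proof. by elim: s => //= x s ->; rewrite ltnn eqxx. Qed.

Lemma wlt_prefix s t : t != [::] -> wlt s (s ++ t).
Proof. by move=> t0; rewrite -{1}[s]cats0 wlt_cat2l; case: t t0. Qed.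

Lemma wlt_cat s t u v : size s = size t ->
  wlt (s ++ u) (t ++ v) = wlt s t || (s == t) && wlt u v.
Proof.
elim: s t => [|x s IH] [|y t] //= [st]; rewrite IH // eqseq_cons.
by case: (x < y)%N; case: (x == y).
Qed.

Lemma wlt_catl s t u : wlt s t -> ~~ prefix s t -> wlt (s ++ u) t.
Proof.
elim: s t => [|x s IH] [|y t] //=.
by case/orP => [-> //|/andP[/eqP <- st]]; rewrite eqxx /= => /(IH _ st) ->; rewrite orbT.
Qed.

Fixpoint foliage (J : rtree m) : word :=
  match J with Leaf i => [:: i] | Node A B => foliage A ++ foliage B end.

Lemma foliage_neq0 J : foliage J != [::].
Proof. by elim: J => //= A; case: (foliage A). Qed.

Lemma size_foliage J : size (foliage J) = (rorder J).+1.
Proof. by elim: J => //= A IA B IB; rewrite size_cat IA IB addnS. Qed.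

(** The trees of the standard bracketings of Lyndon words. *)
Fixpoint lyndon (J : rtree m) : bool :=
  match J with
  | Leaf _ => true
  | Node A B => [&& lyndon A, lyndon B, wlt (foliage A) (foliage B) &
      match A with Leaf _ => true | Node _ A2 => ~~ wlt (foliage A2) (foliage B) end]
  end.

Lemma cat_eq_cat (T : eqType) (a b p s : seq T) : a ++ b = p ++ s ->
  (exists2 q, b = q ++ s & p = a ++ q) \/ (exists2 q, s = q ++ b & a = p ++ q).
Proof.
elim: a p => [|x a IH] [|y p] /=.
- by move=> ->; left; exists [::].
- by move=> ->; left; exists (y :: p).
- by move=> <-; right; exists (x :: a).
- by case=> -> /IH[] [q -> ->]; [left|right]; exists q.
Qed.

(** A Lyndon word is smaller than its proper suffixes, of which the right
    factor of the standard bracketing is the smallest. *)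
Lemma lyndon_suffix J : lyndon J -> forall p s, foliage J = p ++ s -> p != [::] -> s != [::] ->
  wlt (foliage J) s /\ (if J is Node _ B then ~~ wlt s (foliage B) else true).
Proof.
elim: J => [i _ [|x [|y p]] [|z s] //|A IA B IB] /= /and4P[lA lB AB std] p s E p0 s0.
have le : ~~ wlt s (foliage B).
  case: (cat_eq_cat E) => [[q Bq pq]|[q sq Aq]].
    have [q0|q0] := eqVneq q [::]; first by rewrite Bq q0 wltxx.
    by have [/wlt_asym] := IB lB _ _ Bq q0 s0.
  have [q0|q0] := eqVneq q [::]; first by rewrite sq q0 wltxx.
  case: A lA std Aq IA {AB E} => [i|A1 A2] lA std Aq IA.
    by move: p0 q0 Aq; clear; case: p => [|x [|y p]] // _; case: q.
  have [_ qA2] := IA lA _ _ Aq p0 q0.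
  have qB : ~~ wlt q (foliage B).
    by apply: contra std => qB; apply: wle_lt_trans qB.
  apply: contra qB; rewrite sq; apply: wlt_trans; apply: wlt_prefix.
  exact: foliage_neq0.
split=> //; apply: wlt_le_trans le.
have [/prefixP[t Bt]|npre] := boolP (prefix (foliage A) (foliage B)); last exact: wlt_catl.
have t0 : t != [::] by apply/eqP => t0; rewrite Bt t0 cats0 wltxx in AB.
rewrite {2}Bt wlt_cat2l.
by have [] := IB lB _ _ Bt (foliage_neq0 A) t0.
Qed.

Lemma lyndon_Node_lt A B : lyndon (Node A B) -> wlt (foliage A ++ foliage B) (foliage B).
Proof.
by move=> lAB; have [] := lyndon_suffix lAB erefl (foliage_neq0 A) (foliage_neq0 B).
Qed.

Lemma foliage_inj J J' : lyndon J -> lyndon J' -> foliage J = foliage J' -> J = J'.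
Proof.
elim: J J' => [i|A IA B IB] [j|A' B'] lJ lJ' //=.
- by case=> ->.
- by move/(congr1 size); rewrite size_cat !size_foliage addnS.
- by move/(congr1 size); rewrite size_cat !size_foliage addnS.
move=> E; have EB : foliage B = foliage B'.
  have [_ BB'] := lyndon_suffix lJ E (foliage_neq0 A') (foliage_neq0 B').
  have [_ B'B] := lyndon_suffix lJ' (esym E) (foliage_neq0 A) (foliage_neq0 B).
  case: (wlt_total (foliage B) (foliage B')) => //; first by rewrite (negPf B'B).
  by rewrite (negPf BB').
have EA : foliage A = foliage A'.
  have := congr1 (@rev _) E; rewrite EB !rev_cat => /eqP.
  by rewrite eqseq_cat // eqxx => /eqP/(can_inj (@revK _)).
case/and4P: lJ => lA lB _ _; case/and4P: lJ' => lA' lB' _ _.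
by rewrite (IA _ lA lA' EA) (IB _ lB lB' EB).
Qed.

(** * Leading words *)

(** A tree with [l] leaves multiplies by words of length [l], so it shifts the
    support of [f] by [l]. *)
Lemma op_short_gen J k f w : (forall u, (size u < k)%N -> f u = false) ->
  (size w < size (foliage J) + k)%N -> op J f w = false.
Proof.
elim: J k f w => [i|A IA B IB] k f w fk /=.
  by case: w => // j v vk; rewrite fk ?andbF.
rewrite size_cat -addnA => wk; rewrite waddE.
rewrite (IA (size (foliage B) + k)%N) //; last by move=> u; apply: IB.
rewrite (IB (size (foliage A) + k)%N) //; first by move=> u; apply: IA.
by rewrite addnCA.
Qed.

Lemma op_short J f w : (size w < size (foliage J))%N -> op J f w = false.
Proof. by move=> wJ; apply: (op_short_gen (k := 0)); rewrite ?addn0. Qed.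

(** In [A B - B A] every word of [B A] exceeds the foliage, because it starts
    with a word that is at least [foliage B], and [foliage A ++ foliage B] is
    smaller than [foliage B]. *)
Lemma op_lead J : lyndon J -> forall f p v, size p = size (foliage J) ->
  ~~ wlt (foliage J) p -> op J f (p ++ v) = (p == foliage J) && f v.
Proof.
elim: J => [i _ f [|x [|y p]] v //= _|A IA B IB lAB f p v].
  rewrite eqseq_cons andbT => /norP[]; rewrite -leqNgt => xi ix; rewrite eq_sym.
  by case: eqVneq ix.
have AB := lyndon_Node_lt lAB; case/and4P: lAB => lA lB AltB _.
rewrite /= size_cat => ps pAB.
have [p1 [p2 [pE p1s p2s]]] : exists p1 p2, [/\ p = p1 ++ p2, size p1 = size (foliage A) & size p2 = size (foliage B)].
  exists (take (size (foliage A)) p), (drop (size (foliage A)) p); rewrite cat_take_drop.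
  by split=> //; rewrite ?size_takel ?size_drop ?ps ?leq_addr // addKn.
have [q1 [q2 [qE q1s q2s]]] : exists q1 q2, [/\ p = q1 ++ q2, size q1 = size (foliage B) & size q2 = size (foliage A)].
  exists (take (size (foliage B)) p), (drop (size (foliage B)) p); rewrite cat_take_drop.
  by split=> //; rewrite ?size_takel ?size_drop ?ps ?leq_addl // addnK.
rewrite waddE.
have -> : op B (op A f) (p ++ v) = false.
  have pB := wle_lt_trans pAB AB.
  have q1B : wlt q1 (foliage B).
    case: (wlt_total q1 (foliage B)) => // Bq; move: pB; rewrite qE.
      have q20 : q2 != [::] by rewrite -size_eq0 q2s size_eq0 foliage_neq0.
      by rewrite -Bq => /wlt_asym; rewrite wlt_prefix.
    move/wlt_asym; rewrite -[X in wlt X _]cats0 wlt_cat ?q1s //.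
    by rewrite Bq.
  by rewrite qE -catA IB ?wlt_asym //; case: eqP q1B => // ->; rewrite wltxx.
rewrite addr0 {1}pE -catA.
have p1A : ~~ wlt (foliage A) p1.
  by move: pAB; rewrite pE wlt_cat ?p1s // => /norP[].
rewrite IA //; case: eqP => [p1E|p1N] /=; last by rewrite pE eqseq_cat // (introF eqP p1N).
rewrite IB //; first by rewrite pE eqseq_cat // p1E eqxx.
by move: pAB; rewrite pE p1E wlt_cat2l.
Qed.

Lemma coef_lead J : lyndon J -> coef J (foliage J) = true.
Proof. by move=> lJ; rewrite /coef -[foliage J]cats0 op_lead ?wltxx ?eqxx ?cats0. Qed.

Lemma coef_small J w : lyndon J -> size w = size (foliage J) -> wlt w (foliage J) ->
  coef J w = false.
Proof.
move=> lJ ws wJ; rewrite /coef -[w]cats0 op_lead ?wlt_asym //.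
by case: eqP wJ => // ->; rewrite wltxx.
Qed.

(** * Lyndon trees span modulo 2 and squares *)

(** The kernel of the map to the free Lie algebra over [F2]; it is an ideal, by
    [qbr_sq_bracket]. *)
Definition even_or_square (x : L) := exists y z, x = y *+ 2 + qbr z z.

Definition lyndon_below N v (x : L) :=
  (exists J, [/\ lyndon J, size (foliage J) = N, wlt (foliage J) v & x = tr J])
  \/ even_or_square x.

Definition lyndon_of N (x : L) :=
  (exists J, [/\ lyndon J, size (foliage J) = N & x = tr J]) \/ even_or_square x.

Lemma spanned_sub (V : zmodType) (S S' : V -> Prop) x :
  (forall y, S y -> S' y) -> spanned S x -> spanned S' x.
Proof.
move=> SS'; elim=> [y /SS'|| y z _ IHy _ IHz]; [exact: spanned_gen|exact: spanned0|].
exact: spannedB.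
Qed.

Lemma spannedN (V : zmodType) (S : V -> Prop) x : spanned S x -> spanned S (- x).
Proof. by rewrite -sub0r; apply: spannedB; apply: spanned0. Qed.

Lemma spannedD (V : zmodType) (S : V -> Prop) x y :
  spanned S x -> spanned S y -> spanned S (x + y).
Proof. by move=> Sx Sy; rewrite -(opprK y); apply/spannedB/spannedN. Qed.

Lemma spanned_additive (V W : zmodType) (phi : {additive V -> W})
    (S : V -> Prop) (S' : W -> Prop) x :
  (forall y, S y -> spanned S' (phi y)) -> spanned S x -> spanned S' (phi x).
Proof.
move=> SS'; elim=> [y /SS'//||y z _ IHy _ IHz]; first by rewrite raddf0; apply: spanned0.
by rewrite raddfB; apply: spannedB.
Qed.

Lemma even_or_square_bracket x y : even_or_square y -> even_or_square (qbr x y).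
Proof.
case=> [a [b ->]]; exists (qbr x a), 0; rewrite qbrDr [qbr x (qbr b b)]qbr_anti.
by rewrite qbr_sq_bracket oppr0 qbr0 raddfMn.
Qed.

Definition rank N (v : word) : nat := #|[pred s : N.-bseq 'I_m | wlt s v]|.

Lemma rank_lt N v v' : (size v' <= N)%N -> wlt v' v -> (rank N v' < rank N v)%N.
Proof.
move=> v'N v'v; apply/proper_card/properP; split.
  by apply/subsetP => s; rewrite !inE => /wlt_trans; apply.
by exists (Bseq v'N); rewrite !inE /= ?wltxx.
Qed.

(** If [(A, B)] with [A = (A1, A2)] is not a Lyndon tree then [A2] is smaller than
    [B], and [[[A1, A2], B] = [A1, [A2, B]] + [A2, [B, A1]]].  The inner brackets
    have fewer leaves, and expand into trees smaller than [B]; in the outer ones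
    both factors are then smaller than [B].  Hence the induction on the number of
    leaves, and then on the largest factor, whose bound [v] decreases among the
    finitely many words of bounded length. *)
Lemma lyndon_bracket N v A B : (size v <= N)%N -> lyndon A -> lyndon B ->
  (size (foliage A) + size (foliage B))%N = N ->
  ~~ wlt v (foliage A) -> ~~ wlt v (foliage B) ->
  spanned (lyndon_below N v) (tr (Node A B)).
Proof.
elim/ltn_ind: N v A B => N IHN v.
have [k] := ubnP (rank N v); elim: k v => // k IHv v vk A B vN lA lB ABN Av Bv.
wlog AltB : A B lA lB ABN Av Bv / wlt (foliage A) (foliage B).
  move=> H; case: (wlt_total (foliage A) (foliage B)) => AB; first exact: H.
    apply: spanned_gen; right; exists 0, (tr A); rewrite mul0rn add0r qbr_tr.
    by rewrite (foliage_inj lA lB AB).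
  rewrite -qbr_tr qbr_anti qbr_tr; apply: spannedN; apply: H => //.
  by rewrite addnC.
have [lAB|lABN] := boolP (lyndon (Node A B)).
  apply: spanned_gen; left; exists (Node A B); rewrite /= size_cat; split=> //.
  exact: wlt_le_trans (lyndon_Node_lt lAB) Bv.
case: A lA ABN Av AltB lABN => [i|A1 A2] lA ABN Av AltB; first by move: AltB => /= ->; rewrite lB.
rewrite [lyndon _]/= -/(lyndon (Node A1 A2)) lA lB AltB /= negbK => A2B.
have A1B : wlt (foliage A1) (foliage B).
  by apply: wlt_trans AltB; apply: wlt_prefix; apply: foliage_neq0.
case/and4P: (lA) => lA1 lA2 _ _.
have A1_gt0 : (0 < size (foliage A1))%N by rewrite size_foliage.
have A2_gt0 : (0 < size (foliage A2))%N by rewrite size_foliage.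
have B_gt0 : (0 < size (foliage B))%N by rewrite size_foliage.
rewrite /= size_cat in ABN.
(* bracketing again with a third factor stays below [B] *)
have step C D y : lyndon C -> (size (foliage C) + D)%N = N ->
    wlt (foliage C) (foliage B) ->
    lyndon_below D (foliage B) y -> spanned (lyndon_below N v) (qbr (tr C) y).
  move=> lC CDN CB [[E [lE ED EB ->]]|y_triv]; last first.
    by apply: spanned_gen; right; apply: even_or_square_bracket.
  have [w [wB wN Cw Ew]] : exists w, [/\ wlt w (foliage B), (size w <= N)%N,
      ~~ wlt w (foliage C) & ~~ wlt w (foliage E)].
    case: (wlt_total (foliage C) (foliage E)) => [CE|CE|EC].
    - by exists (foliage E); rewrite wltxx wlt_asym //; split=> //; rewrite ED -CDN leq_addl.
    - by exists (foliage E); rewrite CE wltxx; split=> //; rewrite ED -CDN leq_addl.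
    - by exists (foliage C); rewrite wltxx wlt_asym //; split=> //; rewrite -CDN leq_addr.
  have wv : wlt w v := wlt_le_trans wB Bv.
  rewrite qbr_tr; apply: spanned_sub (IHv w _ C E wN lC lE _ Cw Ew); last by rewrite ED.
    by move=> x [[J [lJ JN Jw ->]]|]; [left; exists J; split=> //; apply: wlt_trans wv|right].
  by apply: leq_trans (rank_lt wN wv) _; rewrite -ltnS.
rewrite -!qbr_tr qbr_node; apply: spannedD.
- apply: (spanned_additive (phi := qbr (tr A1))
    (S := lyndon_below (size (foliage A2) + size (foliage B)) (foliage B))) => [y|].
    by apply: step => //; rewrite -ABN addnA.
  rewrite qbr_tr; apply: IHN; rewrite ?wltxx ?wlt_asym ?leq_addl //.
  by rewrite -ABN; lia.
- apply: (spanned_additive (phi := qbr (tr A2))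
    (S := lyndon_below (size (foliage B) + size (foliage A1)) (foliage B))) => [y|].
    by apply: step => //; rewrite -ABN; lia.
  rewrite qbr_tr; apply: IHN; rewrite ?wltxx ?wlt_asym ?leq_addr //.
  by rewrite -ABN; lia.
Qed.

Lemma lyndon_spanned J : spanned (lyndon_of (size (foliage J))) (tr J).
Proof.
elim: J => [i|A IA B IB].
  by apply: spanned_gen; left; exists (Leaf i).
rewrite -qbr_tr; move: IB; apply: (spanned_additive (phi := qbr (tr A))) => y yB.
change (spanned (lyndon_of (size (foliage (Node A B)))) (qbr_r y (tr A))); move: IA; apply: (spanned_additive (phi := qbr_r y)) => x xA.
rewrite /= /qbr_r; case: xA => [[C [lC CA ->]]|x_triv]; last first.
  rewrite qbr_anti; apply: spannedN; apply: spanned_gen; right.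
  exact: even_or_square_bracket.
case: yB => [[D [lD DB ->]]|y_triv]; last first.
  by apply: spanned_gen; right; apply: even_or_square_bracket.
have [v [vN Cv Dv]] : exists v, [/\ (size v <= size (foliage C) + size (foliage D))%N,
      ~~ wlt v (foliage C) & ~~ wlt v (foliage D)].
  case: (wlt_total (foliage C) (foliage D)) => [CD|CD|DC].
  - by exists (foliage D); rewrite wltxx wlt_asym //; split=> //; rewrite leq_addl.
  - by exists (foliage D); rewrite CD wltxx; split=> //; rewrite leq_addl.
  - by exists (foliage C); rewrite wltxx wlt_asym //; split=> //; rewrite leq_addr.
rewrite qbr_tr; apply: spanned_sub (lyndon_bracket vN lC lD erefl Cv Dv) => z.
case=> [[E [lE EN _ ->]]|]; last by right.
by left; exists E; rewrite EN CA DB /= size_cat.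
Qed.

End Lyndon.

(** * The free Lie algebra over [F2] in the associative one *)

Section Embedding.
Variable m : nat.
Notation L := (quasi_lie m).

Lemma op_long_gen (J : rtree m) k (f : seq 'I_m -> bool) w :
  (forall u, (k < size u)%N -> f u = false) ->
  (size (foliage J) + k < size w)%N -> op J f w = false.
Proof.
elim: J k f w => [i|A IA B IB] k f w fk /=.
  by case: w => // j v vk; rewrite fk ?andbF.
rewrite size_cat -addnA => wk; rewrite waddE.
rewrite (IA (size (foliage B) + k)%N) //; last by move=> u; apply: IB.
rewrite (IB (size (foliage A) + k)%N) //; first by move=> u; apply: IA.
by rewrite addnCA.
Qed.

Lemma coef_size (J : rtree m) w : size w <> size (foliage J) -> coef J w = false.
Proof.
case: (ltngtP (size w) (size (foliage J))) => // [wJ|Jw] _; first exact: op_short.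
by apply: (op_long_gen (k := 0)); rewrite ?addn0 // => -[].
Qed.

Lemma qcoef_square w (z : L) : qcoef w (qbr z z) = 0.
Proof.
move: z; apply: qlie_ind => [|x y Hx Hy|J].
- by rewrite qbr0 raddf0.
- by rewrite qbr_sqB raddfB Hx Hy subrr.
- by rewrite qbr_tr qcoef_tr coef_Node waddE bool_addxx.
Qed.

(** The additive maps that factor through the degree [N] part of the free Lie
    algebra over [F2]. *)
Definition insensitive N (G : zmodType) (phi : {additive L -> G}) :=
  [/\ forall y, phi y *+ 2 = 0, forall z, phi (qbr z z) = 0
    & forall J : rtree m, size (foliage J) <> N -> phi (tr J) = 0].

Lemma qcoef_insensitive w : insensitive (size w) (qcoef w).
Proof.
split=> [y|z|J Jw]; first by rewrite mulr2n bool_addxx.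
  exact: qcoef_square.
by rewrite qcoef_tr coef_size // => E; apply: Jw.
Qed.

(** An expansion of [x] over Lyndon trees, as seen by all these maps; a tree may
    be repeated in [s]. *)
Lemma lyndon_list N (x : L) : exists s : seq (rtree m),
  (forall J, J \in s -> lyndon J /\ size (foliage J) = N) /\
  (forall (G : zmodType) (phi : {additive L -> G}), insensitive N phi ->
     phi x = \sum_(J <- s) phi (tr J)).
Proof.
pose P x := exists s : seq (rtree m),
  (forall J, J \in s -> lyndon J /\ size (foliage J) = N) /\
  (forall (G : zmodType) (phi : {additive L -> G}), insensitive N phi ->
     phi x = \sum_(J <- s) phi (tr J)).
have P0 : P 0 by exists [::]; split=> // G phi _; rewrite big_nil raddf0.
have PB y z : P y -> P z -> P (y - z).
  move=> [s [sN sE]] [s' [s'N s'E]]; exists (s ++ s'); split=> [J|G phi phiN].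
    by rewrite mem_cat => /orP[/sN|/s'N].
  rewrite big_cat raddfB (sE _ _ phiN) (s'E _ _ phiN); congr (_ + _).
  have [phi2 _ _] := phiN; rewrite -(s'E _ _ phiN).
  by apply/esym/eqP; rewrite -addr_eq0 -mulr2n phi2.
move: x; apply: qlie_ind => [//|//|J].
have [JN|JN] := eqVneq (size (foliage J)) N; last first.
  by exists [::]; split=> // G phi [_ _ ->]; [rewrite big_nil|apply/eqP].
have := lyndon_spanned J; rewrite JN.
elim=> [y [[K [lK KN ->]]|[a [b ->]]]|//|y z _ Py _ Pz]; last exact: PB.
  exists [:: K]; split=> [K'|G phi _]; last by rewrite big_seq1.
  by rewrite inE => /eqP ->.
exists [::]; split=> // G phi [phi2 phisq _].
by rewrite big_nil raddfD raddfMn /= phi2 phisq addr0.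
Qed.

Lemma exists_wlt_min (s : seq (rtree m)) K : K \in s ->
  exists2 J, J \in s & forall J', J' \in s -> ~~ wlt (foliage J') (foliage J).
Proof.
elim: s K => // K s IH _ _.
case: s IH => [|K' s] IH; first by exists K; rewrite ?inE // => J'; rewrite inE => /eqP ->; rewrite wltxx.
have [J Js Jmin] := IH K' (mem_head _ _).
have [KJ|KJ] := boolP (wlt (foliage K) (foliage J)).
  exists K; first exact: mem_head.
  move=> J'; rewrite inE => /predU1P[->|/Jmin J'J]; first by rewrite wltxx.
  by apply: contra J'J => /wlt_trans; apply.
exists J; first by rewrite inE Js orbT.
by move=> J'; rewrite inE => /predU1P[->|/Jmin].
Qed.

(** The free Lie algebra over [F2], which is [L] modulo doubles and squares,
    embeds into the free associative algebra: the leading words of distinct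
    Lyndon trees are distinct, so in an expansion with zero coefficients the tree
    with the smallest foliage occurs an even number of times, and drops out. *)
Lemma insensitive_eq0 N (x : L) : (forall w, size w = N -> qcoef w x = 0) ->
  forall (G : zmodType) (phi : {additive L -> G}), insensitive N phi -> phi x = 0.
Proof.
have [s [sN sE]] := lyndon_list N x => x0 G phi phiN; rewrite (sE _ _ phiN).
have s0 w : size w = N -> \sum_(J <- s) coef J w = 0 :> bool.
  move=> wN; rewrite -[RHS](x0 w wN) (sE bool (qcoef w)); first by apply: eq_bigr => J _; rewrite qcoef_tr.
  by rewrite -wN; apply: qcoef_insensitive.
have [k] := ubnP (size s); elim: k s {sE x0} sN s0 => // k IH s sN s0 sk.
case: s sN s0 sk => [|K s]; first by rewrite big_nil.
set S := K :: s => sN s0 sk.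
have [J JS Jmin] := exists_wlt_min (mem_head K s).
have [lJ JN] := sN J JS.
have evenJ : ~~ odd (count_mem J S).
  have := s0 (foliage J) JN; rewrite (bigID (pred1 J)) /= [X in _ + X]big_seq_cond [X in _ + X]big1 ?addr0.
    rewrite (eq_bigr (fun=> true)) => [|J' /eqP ->]; last exact: coef_lead.
    have oddE c : (true : bool) *+ c = odd c by elim: c => //= c; rewrite mulrS => ->.
    by rewrite big_const_seq iter_addr_0 oddE => ->.
  move=> J' /andP[/[dup] /sN[lJ' J'N] /Jmin J'J J'NJ].
  apply: coef_small; rewrite ?J'N //; case: (wlt_total (foliage J) (foliage J')) => // JJ'.
    by rewrite (foliage_inj lJ lJ' JJ') eqxx in J'NJ.
  by rewrite JJ' in J'J.
have [phi2 _ _] := phiN.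
rewrite (bigID (pred1 J)) /= [X in X + _](_ : _ = 0) ?add0r; last first.
  rewrite (eq_bigr (fun=> phi (tr J))) => [|J' /eqP -> //].
  by rewrite big_const_seq iter_addr_0 -(even_halfK evenJ) -mul2n mulrnA phi2 mul0rn.
rewrite -big_filter; apply: IH => [J'|w wN|]; first by rewrite mem_filter => /andP[_ /sN].
  rewrite big_filter; have := s0 w wN; rewrite (bigID (pred1 J)) /= [X in X + _](_ : _ = 0) ?add0r //.
  rewrite (eq_bigr (fun=> coef J w)) => [|J' /eqP -> //].
  by rewrite big_const_seq iter_addr_0 -(even_halfK evenJ) -mul2n mulrnA mulr2n bool_addxx mul0rn.
rewrite size_filter; move: sk; rewrite ltnS; apply: leq_trans.
have J_gt0 : (0 < count_mem J S)%N by rewrite -has_count has_pred1.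
change (count (predC (pred1 J)) S < size S)%N.
by rewrite -(count_predC (pred1 J) S) -[X in (X < _)%N]add0n ltn_add2r.
Qed.

End Embedding.

(** * Sums over leaves with values in the quasi-Lie algebra *)

Section LieSums.
Variables (m : nat) (G : zmodType) (g : 'I_m -> {additive quasi_lie m -> G}).
Notation L := (quasi_lie m).

(** [leaf_sum] for values that are additive in the rest of the tree.  The rest is
    an element of the quasi-Lie algebra instead of a tree, so that the relations
    in it hold by construction. *)
Fixpoint lsum (I : rtree m) (y : L) : G :=
  match I with
  | Leaf i => g i y
  | Node A B => lsum A (qbr (tr B) y) + lsum B (qbr y (tr A))
  end.

Lemma lsum_is_zmod_morphism I : zmod_morphism (lsum I).
Proof.
elim: I => [i|A IA B IB] x y /=; first exact: raddfB.
by rewrite qbrBr qbrBl IA IB; abel.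
Qed.
HB.instance Definition _ I := GRing.isZmodMorphism.Build L G (lsum I) (lsum_is_zmod_morphism I).

Lemma lsumN I y : lsum I (- y) = - lsum I y. Proof. exact: raddfN. Qed.
Lemma lsumD I x y : lsum I (x + y) = lsum I x + lsum I y. Proof. exact: raddfD. Qed.
Lemma lsumB I x y : lsum I (x - y) = lsum I x - lsum I y. Proof. exact: raddfB. Qed.
Lemma lsum0 I : lsum I 0 = 0. Proof. exact: raddf0. Qed.

Lemma leaf_sum_lsum I K : leaf_sum (fun i J => g i (tr J)) I K = lsum I (tr K).
Proof. by elim: I K => //= A IA B IB K; rewrite IA IB !qbr_tr. Qed.

Lemma lsum_compat y : lie_compat (lsum^~ y).
Proof.
split=> [J J' JJ'|I H X IHX].
- elim: JJ' y => {J J'} [A B|A A' B AA' IH|A B B' BB' IH] y /=.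
  + by rewrite [qbr (tr A) y]qbr_anti [qbr (tr B) y]qbr_anti !lsumN; abel.
  + have E : lsum B (qbr y (tr A)) + lsum B (qbr y (tr A')) = 0.
      by rewrite -lsumD -qbrDr (tr_compat m).1 // qbr0 lsum0.
    by rewrite addrACA IH E addr0.
  + have E : lsum A (qbr (tr B) y) + lsum A (qbr (tr B') y) = 0.
      by rewrite -lsumD -qbrDl (tr_compat m).1 // qbr0l lsum0.
    by rewrite addrACA IH E addr0.
- elim: IHX y => {I H X} [A B C|I H X B IHX IH|A I H X IHX IH] y /=.
  + pose a := qbr (tr (Node B C)) y - qbr (tr B) (qbr (tr C) y) + qbr (tr C) (qbr (tr B) y).
    pose b := qbr (tr C) (qbr y (tr A)) - qbr (qbr (tr C) y) (tr A) + qbr y (tr (Node A C)).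
    pose c := qbr (qbr y (tr A)) (tr B) - qbr y (tr (Node A B)) + qbr (qbr (tr B) y) (tr A).
    have a0 : a = 0 by rewrite /a -qbr_tr qbr_node [qbr y _]qbr_anti qbrNr; abel.
    have b0 : b = 0 by rewrite /b -qbr_tr [qbr (qbr _ _) _]qbr_node; abel.
    have c0 : c = 0.
      rewrite /c -qbr_tr [qbr (qbr y _) _]qbr_node [qbr (qbr _ y) _]qbr_anti; abel.
    transitivity (lsum A a + lsum B b + lsum C c); last by rewrite a0 b0 c0 !lsum0 !addr0.
    by rewrite !(lsumD, lsumN); abel.
  + transitivity (lsum I (qbr (tr B) y) - lsum H (qbr (tr B) y) + lsum X (qbr (tr B) y)
      + lsum B (qbr y (tr I - tr H + tr X))); last first.
      by rewrite IH (tr_compat m).2 // qbr0 lsum0 addr0.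
    by rewrite qbrDr qbrBr lsumD lsumB; abel.
  + transitivity (lsum I (qbr y (tr A)) - lsum H (qbr y (tr A)) + lsum X (qbr y (tr A))
      + lsum A (qbr (tr I - tr H + tr X) y)); last first.
      by rewrite IH (tr_compat m).2 // qbr0l lsum0 addr0.
    by rewrite qbrDl qbrBl lsumD lsumB; abel.
Qed.

(** The vanishing of [lsum A B + lsum B A], the sum over all the leaves of
    [<A, B>], makes [(A, B) |-> lsum A B] antisymmetric at the root.  For the tree
    [<A, (B, C)>] the sum has one part for each of [A], [B] and [C], and its
    vanishing is the Jacobi relation at the root. *)
Lemma lsum_root n : (forall A B, (rorder A + rorder B).+1 = n ->
    lsum A (tr B) + lsum B (tr A) = 0) ->
  exists phi : {additive L -> G}, (forall A B, (rorder A + rorder B).+1 = n ->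
    phi (tr (Node A B)) = lsum A (tr B)) /\ (forall J, rorder J <> n -> phi (tr J) = 0).
Proof.
move=> sum0.
pose f (J : rtree m) := if rorder J == n then
  if J is Node A B then lsum A (tr B) else 0 else 0.
have f_compat : lie_compat f.
  split=> [J J' JJ'|I H X IHX].
    rewrite /f (rneg_order JJ'); case: eqP => [Jn|_]; last exact: addr0.
    case: JJ' Jn => {J J'} [A B|A A' B AA'|A B B' BB'] /= Jn.
    - exact: sum0.
    - exact: (lsum_compat (tr B)).1.
    - by rewrite -lsumD (tr_compat m).1 // lsum0.
  have [EH EX] := rihx_order IHX; rewrite /f EH EX.
  case: eqP => [In|_]; last by rewrite subr0 addr0.
  case: IHX In {EH EX} => {I H X} [A B C|I H X B IHX|A I H X IHX] /= In.
  - have /= := sum0 A (Node B C) In; rewrite -!qbr_tr => E.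
    rewrite [qbr (tr C) (tr B)]qbr_anti lsumN -[RHS]oppr0 -E.
    by rewrite [qbr (tr B) (tr A)]qbr_anti !lsumN; abel.
  - exact: (lsum_compat (tr B)).2.
  - by rewrite -lsumB -lsumD (tr_compat m).2 // lsum0.
exists (qlift f_compat); split=> [A B ABn|J /eqP/negPf Jn].
  by rewrite /= qliftE /f /= ABn eqxx.
by rewrite /= qliftE /f Jn.
Qed.

End LieSums.

Lemma lsum_additive m (G H : zmodType) (g : 'I_m -> {additive quasi_lie m -> G})
    (h : 'I_m -> {additive quasi_lie m -> H}) (phi : {additive G -> H}) :
  (forall i y, phi (g i y) = h i y) -> forall I y, phi (lsum g I y) = lsum h I y.
Proof. by move=> gh; elim=> [i|A IA B IB] y //=; rewrite raddfD IA IB. Qed.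

(** * The second exact sequence *)

Section SecondSequence.
Variables m n : nat.
Hypothesis n_gt0 : (0 < n)%N.
Notation L := (quasi_lie m).
Notation N := (2 * n).-1.
Notation TN := (T m N).
Notation TT := (Ttilde m n).
Notation LT := (tensor 'Z_2 (Lprime m n.+1)).

(** The class of [<i, (J, J)> = <(i, J), J>]; it is additive in [J] because
    squares are additive in a quasi-Lie algebra. *)
Definition twist (i : 'I_m) (x : L) : TN := form N (tr (Leaf i)) (qbr x x).

Lemma twist_is_zmod_morphism i : zmod_morphism (twist i).
Proof. by move=> x y; rewrite /twist qbr_sqB formBr. Qed.
HB.instance Definition _ i := GRing.isZmodMorphism.Build L TN (twist i)
  (twist_is_zmod_morphism i).

Lemma twist_tr i J : twist i (tr J) = gl N (Leaf i) (Node J J).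
Proof. by rewrite /twist qbr_tr form_tr. Qed.

Lemma twist_gl i J : twist i (tr J) = gl N (Node (Leaf i) J) J.
Proof. by rewrite twist_tr gl_move. Qed.

Lemma twist_default i J : (rorder J).+1 <> n -> twist i (tr J) = 0.
Proof. by move=> Jn; rewrite twist_tr gl_default //=; lia. Qed.

Lemma twist2 i x : twist i x *+ 2 = 0.
Proof. by rewrite /twist -[_ *+ 2](raddfMn (form N (tr (Leaf i)))) qbr_sq2 (raddf0 (form N _)). Qed.

Definition Delta_tree A B : TN := lsum twist A (tr B) + lsum twist B (tr A).

(** The relations of [Ttilde], freed from graphs. *)
Lemma Delta_valueP x : Delta_value (n := n) x ->
  exists A B, (rorder A + rorder B).+1 = n /\ x = Delta_tree A B.
Proof.
case=> t w wP; have [A [B tAB]] := utree_glued t; exists A, B; split.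
  by rewrite (utree_order tAB) prednK.
rewrite (sum_univalent (g := fun i J => twist i (tr J)) (utree_tree t) _ tAB) ?leaf_sum_lsum //.
move=> v Tv vu vTv; have [Tv' vTv' wv] := wP v vu.
by rewrite (subtree_fun vTv vTv') twist_tr (Tcl_gl wv).
Qed.

Lemma Delta_tree_value A B : (rorder A + rorder B).+1 = n ->
  Delta_value (n := n) (Delta_tree A B).
Proof.
move=> ABn; have [|t _ tAB] := @gl_tree m n.-1 A B; first by rewrite -ABn.
have i0 : 'I_m by clear -A; elim: A.
have wex (i : 'I_m) (J : rtree m) : (rorder J).+1 = n ->
    exists u : utree m N, glued (val u) (Leaf i) (Node J J).
  move=> Jn; have [|u _ uJ] := @gl_tree m N (Leaf i) (Node J J); last by exists u.
  by rewrite /=; lia.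
have ordT (v : halfedge (val t)) Tv : univalent v -> subtree (mate v) Tv -> (rorder Tv).+1 = n.
  move=> vu vTv; have := @utree_order m _ t (Leaf (leaf_label v)) Tv.
  by rewrite /= add0n => ->; [rewrite prednK|exists v => //; left].
(* a tree of the right order, the value of [w] away from univalent vertices *)
pose comb := iter n.-1 (Node (Leaf i0)) (Leaf i0).
have comb_order : (rorder comb).+1 = n.
  have -> : rorder comb = n.-1 by rewrite /comb; elim: (n.-1) => //= k ->.
  by rewrite prednK.
have [u0 _] := wex i0 comb comb_order.
have wP (v : halfedge (val t)) : exists u : utree m N, univalent v ->
    exists2 Tv, subtree (mate v) Tv & glued (val u) (Leaf (leaf_label v)) (Node Tv Tv).
  have [vu|_] := boolP (univalent v); last by exists u0.
  have [Tv vTv] := subtree_exists (mate v) (utree_tree t).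
  by have [u uP] := wex (leaf_label v) Tv (ordT v Tv vu vTv); exists u => _; exists Tv.
have [w wP'] := choice wP.
have := Delta_sum wP'; rewrite (sum_univalent (g := fun i J => twist i (tr J)) (utree_tree t) _ tAB).
  by rewrite !leaf_sum_lsum.
move=> v Tv vu vTv; have [Tv' vTv' wv] := wP' v vu.
by rewrite (subtree_fun vTv vTv') twist_tr (Tcl_gl wv).
Qed.

Definition twist_bar (i : 'I_m) : {additive L -> TT} := zpi (@Delta_value m n) \o twist i.

Lemma twist_barE I y : zpi (@Delta_value m n) (lsum twist I y) = lsum twist_bar I y.
Proof. exact: lsum_additive. Qed.

Lemma lsum_twist2 I y : lsum twist_bar I y *+ 2 = 0.
Proof.
elim: I y => [i|A IA B IB] y /=; last by rewrite mulrnDl IA IB addr0.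
by rewrite -raddfMn twist2 raddf0.
Qed.

(** The root relations of [Z/2 (x) L'] hold because the sum over all leaves is a
    value of [Delta], and the classes are 2-torsion. *)
Lemma exists_boundary : exists f : {additive LT -> TT}, forall A B,
  (rorder A + rorder B).+1 = n -> f (tau n (tr (Node A B))) = lsum twist_bar A (tr B).
Proof.
have [A B ABn|phi [phiE phi0]] := @lsum_root m TT twist_bar n.
  by rewrite -!twist_barE -raddfD; apply/zpi_rel/Delta_tree_value.
have phi2 x : phi x *+ 2 = 0.
  move: x; apply: qlie_ind => [|x y Hx Hy|J]; first by rewrite raddf0 mul0rn.
    by rewrite (raddfB phi) mulrnBl Hx Hy subr0.
  have [Jn|Jn] := eqVneq (rorder J) n; last by rewrite phi0 ?mul0rn //; apply/eqP.
  case: J Jn => [i|A B] /= Jn; last by rewrite phiE ?lsum_twist2.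
  by exfalso; move: n_gt0; rewrite -Jn.
have [f fE] := @tensor_lift m n TT phi phi2.
by exists f => A B ABn; rewrite fE ?phiE.
Qed.

Section Boundary.
Variable f : {additive LT -> TT}.
Hypothesis fE : forall A B, (rorder A + rorder B).+1 = n ->
  f (tau n (tr (Node A B))) = lsum twist_bar A (tr B).

Lemma tau_default (J : rtree m) : rorder J <> n -> tau n (tr J) = 0.
Proof. by move=> /eqP/negPf Jn; rewrite tau_tr /tens_tree Jn. Qed.

Lemma Ttilde_to_Tinf_twist i x : Ttilde_to_Tinf m n (twist_bar i x) = 0.
Proof.
move: x; apply: qlie_ind => [|x y Hx Hy|J]; first by rewrite !raddf0.
  by rewrite (raddfB (twist_bar i)) raddfB Hx Hy subr0.
have [Jn|Jn] := eqVneq (rorder J).+1 n; last first.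
  by rewrite /= twist_default ?raddf0 //; apply/eqP.
have Jn' : rorder J == n.-1 by rewrite -Jn.
have [|t tE tJ] := @gl_tree m N (Node (Leaf i) J) J; first by rewrite /=; lia.
rewrite /= twist_gl tE; apply: zpi_rel.
exact: (@boundary_twist m n i (Sub J Jn') t).
Qed.

Lemma boundary_Tinf z : Ttilde_to_Tinf m n (f z) = 0.
Proof.
have [x <-] := tau_surj z; move: x.
apply: qlie_ind => [|x y Hx Hy|J]; first by rewrite !raddf0.
  by rewrite (raddfB (tau n)) !raddfB Hx Hy subr0.
have [Jn|/eqP Jn] := eqVneq (rorder J) n; last by rewrite tau_default // !raddf0.
case: J Jn => [i|A B] /= Jn; first by exfalso; move: n_gt0; rewrite -Jn.
rewrite fE //; elim: A {Jn} (tr B) => [i|A1 I1 A2 I2] y; first exact: Ttilde_to_Tinf_twist.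
rewrite [lsum _ _ _]/= raddfD.
by rewrite /= (I1 (qbr (tr A2) y)) (I2 (qbr y (tr A1))) addr0.
Qed.

Lemma boundary_ker y : Ttilde_to_Tinf m n y = 0 -> exists z, f z = y.
Proof.
move/zpi_eq0; elim=> [_ [i J t tJ]||u v _ [z <-] _ [z' <-]].
- exists (tau n (tr (Node (Leaf i) (val J)))).
  have Jn := eqP (valP J); rewrite fE /= ?Jn ?add0n ?prednK //.
  by congr zpi; rewrite twist_gl (Tcl_gl tJ).
- by exists 0; rewrite raddf0.
- by exists (z - z'); rewrite raddfB.
Qed.

(** Elements of [V (x) L'], by their components. *)
Notation P := {ffun 'I_m -> L}.

Definition single (i : 'I_m) (x : L) : P := [ffun j => if j == i then x else 0].
Lemma single_is_zmod_morphism i : zmod_morphism (single i).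
Proof. by move=> x y; apply/ffunP => j; rewrite !ffunE; case: eqP; rewrite ?subr0. Qed.
HB.instance Definition _ i := GRing.isZmodMorphism.Build L P (single i)
  (single_is_zmod_morphism i).

Definition twists (y : P) : TN := \sum_i twist i (y i).
Lemma twists_is_zmod_morphism : zmod_morphism twists.
Proof. by move=> x y; rewrite /twists -sumrB; apply: eq_bigr => i _; rewrite !ffunE raddfB. Qed.
HB.instance Definition _ := GRing.isZmodMorphism.Build P TN twists twists_is_zmod_morphism.

Definition tau_bracket (i : 'I_m) : {additive L -> LT} := tau n \o qbr (tr (Leaf i)).

Definition brackets (y : P) : LT := \sum_i tau_bracket i (y i).
Lemma brackets_is_zmod_morphism : zmod_morphism brackets.
Proof. by move=> x y; rewrite /brackets -sumrB; apply: eq_bigr => i _; rewrite !ffunE raddfB. Qed.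
HB.instance Definition _ := GRing.isZmodMorphism.Build P LT brackets brackets_is_zmod_morphism.

Lemma twists_single i x : twists (single i x) = twist i x.
Proof.
rewrite /twists (bigD1 i) //= ffunE eqxx big1 ?addr0 // => j /negPf ji.
by rewrite ffunE ji raddf0.
Qed.

Lemma brackets_single i x : brackets (single i x) = tau_bracket i x.
Proof.
rewrite /brackets (bigD1 i) //= ffunE eqxx big1 ?addr0 // => j /negPf ji.
by rewrite ffunE ji qbr0 raddf0.
Qed.

(** The part over the leaves of [A] of the sum of the [i(v) (x) T_v] in the tree
    [<A, y>]. *)
Definition eta (A : rtree m) (y : L) : P := lsum single A y.

Lemma twists_eta A y : twists (eta A y) = lsum twist A y.
Proof. exact: (lsum_additive twists_single). Qed.

(** Each [[i(v), T_v]] is the tree rooted next to [v]; by the Jacobi identity the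
    sum over [A] moves the root to the cut. *)
Lemma brackets_eta A y : brackets (eta A y) = tau n (qbr (tr A) y).
Proof.
rewrite /eta (lsum_additive (h := tau_bracket) brackets_single).
elim: A y => [i|A IA B IB] y //=.
by rewrite IA IB -raddfD -qbr_node qbr_tr.
Qed.

Lemma boundary_brackets y : f (brackets y) = zpi (@Delta_value m n) (twists y).
Proof.
rewrite /brackets /twists !raddf_sum; apply: eq_bigr => i _ /=.
move: (y i); apply: qlie_ind => [|u v Hu Hv|J].
- by rewrite qbr0 !raddf0.
- by rewrite qbrBr (raddfB (tau n)) (raddfB f) Hu Hv (raddfB (twist i)) raddfB.
rewrite qbr_tr; have [Jn|/eqP Jn] := eqVneq (rorder J).+1 n; first by rewrite fE.
by rewrite tau_default ?twist_default //= ?raddf0 // raddf0.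
Qed.

Lemma brackets_surj z : exists y, brackets y = z.
Proof.
have [x <-] := tau_surj z; move: x.
apply: qlie_ind => [|a b [u ua] [v vb]|J]; first by exists 0; rewrite !raddf0.
  by exists (u - v); rewrite (raddfB brackets) (raddfB (tau n)) /= ua vb.
case: J => [i|A B].
  exists 0; rewrite raddf0 tau_default //= => n0.
  by exfalso; move: n_gt0; rewrite -n0.
by exists (eta A (tr B)); rewrite brackets_eta qbr_tr.
Qed.

(** Summing over all the leaves does not depend on the cut, so it is defined on
    the group of trees. *)
Lemma eta_ex : exists h : {additive TN -> P}, forall A B,
  (rorder A + rorder B)%N = N -> h (gl N A B) = eta A (tr B) + eta B (tr A).
Proof.
apply: (@Tlift m P (fun A B => eta A (tr B) + eta B (tr A))) => [A B|A B C|A B C|A B C D].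
- exact: addrC.
- by rewrite /eta /= !qbr_tr; abel.
- rewrite addrACA -/(eta _ _) (lsum_compat single (tr C)).1; last by constructor.
  by rewrite add0r -lsumD (tr_compat m).1 ?lsum0 //; constructor.
- transitivity (eta (Node A (Node B C)) (tr D) - eta (Node (Node A B) C) (tr D)
      + eta (Node (Node A C) B) (tr D)
      + eta D (tr (Node A (Node B C)) - tr (Node (Node A B) C) + tr (Node (Node A C) B))).
    by rewrite /eta lsumD lsumB; abel.
  rewrite (lsum_compat single (tr D)).2; last by constructor.
  rewrite (tr_compat m).2; last by constructor.
  by rewrite /eta lsum0 addr0.
Qed.

(** In the sum over the leaves of [<i, (J, J)>] the two copies of a leaf of [J]
    cancel, and [i (x) [J, J]] is left.  So the vanishing of the twists gives that
    of the squares of the components of [y], hence of their coefficients in the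
    free associative algebra over [F2].  So these components consist of doubles
    and squares, which are killed by the brackets with generators. *)
Lemma twists_eq0 y : twists y = 0 -> brackets y = 0.
Proof.
move=> y0; have [h hE] := eta_ex.
have hw i j x w : size w = n -> qdiag w (h (twist i x) j) = if j == i then qcoef w x else 0.
  move=> wn; move: x; apply: qlie_ind => [|u v Hu Hv|J].
  - by rewrite !raddf0 ffunE raddf0 if_same.
  - rewrite (raddfB (twist i)) (raddfB h) !ffunE (raddfB (qdiag w)) Hu Hv.
    by case: eqP => _; rewrite ?raddfB ?subrr.
  have [Jn|/eqP Jn] := eqVneq (rorder J).+1 n; last first.
    rewrite twist_default // raddf0 ffunE raddf0 qcoef_tr coef_size ?if_same //.
    by rewrite wn size_foliage => E; apply: Jn.
  have eta0 : eta (Node J J) (tr (Leaf i)) = 0.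
    by rewrite /eta /= [qbr (tr (Leaf i)) _]qbr_anti lsumN subrr.
  rewrite twist_tr hE; last by rewrite /=; lia.
  rewrite eta0 addr0 /eta [lsum _ _ _]/= ffunE.
  by case: eqP => _; rewrite ?raddf0 // qdiag_square qcoef_tr.
rewrite /brackets big1 // => i _.
apply: (@insensitive_eq0 m n (y i)) => [w wn|].
  have := congr1 (fun z => qdiag w (h z i)) y0.
  rewrite raddf0 ffunE raddf0 => <-; rewrite /twists raddf_sum sum_ffunE raddf_sum.
  rewrite (bigD1 i) //= hw // eqxx big1 ?addr0 // => j /negPf ji.
  by rewrite hw // eq_sym ji.
split=> [z|z|J Jn] /=; first exact: tau2.
- by rewrite qbr_anti qbr_sq_bracket oppr0 raddf0.
- by rewrite qbr_tr tau_default //= => E; apply: Jn; rewrite size_foliage -E.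
Qed.

Lemma Delta_brackets x : spanned (@Delta_value m n) x ->
  exists2 u, twists u = x & brackets u = 0.
Proof.
elim=> [_ /Delta_valueP[A [B [ABn ->]]]||a b _ [u <- u0] _ [v <- v0]].
- exists (eta A (tr B) + eta B (tr A)); first by rewrite raddfD /= !twists_eta.
  rewrite (raddfD brackets) /= !brackets_eta -raddfD [qbr (tr B) _]qbr_anti subrr.
  exact: raddf0.
- by exists 0; rewrite raddf0.
- exists (u - v); first exact: raddfB.
  by rewrite (raddfB brackets) /= u0 v0 subrr.
Qed.

(** A [y] whose twists are values of [Delta] may be corrected by values of [eta],
    which have zero brackets, so that its twists vanish. *)
Lemma boundary_inj : injective f.
Proof.
apply: raddf_inj => z; have [y <-] := brackets_surj z.
rewrite boundary_brackets => /zpi_eq0/Delta_brackets[u uy u0].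
have -> : brackets y = brackets (y - u) + brackets u by rewrite -raddfD subrK.
rewrite u0 addr0; apply: twists_eq0.
have -> : twists (y - u) = twists y - twists u by apply: raddfB.
by rewrite uy subrr.
Qed.

End Boundary.

Lemma second_sequence : exists f : {additive LT -> TT}, short_exact f (Ttilde_to_Tinf m n).
Proof.
have [f fE] := exists_boundary; exists f; split=> [|y|z].
- exact: boundary_inj fE.
- split; first exact: boundary_ker.
  by case=> z <-; apply: boundary_Tinf.
- exact: zpi_surj.
Qed.

End SecondSequence.

Local Close Scope quotient_scope.
Local Close Scope ring_scope.

Theorem theorem6 (m n : nat) (m_gt0 : 0 < m) (n_gt0 : 0 < n) :
  (exists g : {additive Tinf_even m n -> tensor 'Z_2 (Lprime m n.+1)},
     short_exact (T_to_Tinf m n) g) /\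
  (exists f : {additive tensor 'Z_2 (Lprime m n.+1) -> Ttilde m n},
     short_exact f (Ttilde_to_Tinf m n)).
Proof. by split; [apply: first_sequence|apply: second_sequence]. Qed.
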